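(* Let $A\in\mathbb M_{N\times N}$, $B=(b_1,\dots,b_M)\in\mathbb M_{N\times M}$ with $1\le M\le N$, $N\ge2$, such that $\mathrm{rank}[b_i,Ab_i,\dots,A^{N-1}b_i]=N$ for each $i=1,\dots,M$, and $k:=\mathrm{rank}B<N$. Let $T$ be the minimum time function to reach the origin for $\dot x=Ax+Bu$, $u\in[-1,1]^M$, and let $$\mathcal S=\Big\{x\in\mathbb R^N:\ \exists\, r>0,\ \zeta\in\mathbb S^{N-1}\text{ with } x=\sum_{i=1}^M\int_0^r e^{A(t-r)}b_i\,\mathrm{sign}(\langle\zeta,e^{At}b_i\rangle)\,dt\ \text{ and }\ \langle\zeta,b_i\rangle=0\ \forall i=1,\dots,M\Big\}.$$ Let $\bar x\in\mathbb R^N\setminus\{0\}$. Then $T$ is non-Lipschitz at $\bar x$ if and only if $\bar x\in\mathcal S$. Moreover, $\mathcal S$ is invariant for optimal trajectories of the reversed dynamics $\dot x=-Ax-Bu$, $u\in[-1,1]^M$, $x(0)=0$, having vanishing minimized Hamiltonian.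
   Context: $T(x)$ is the infimum of times $\theta\ge0$ such that some measurable control $u:[0,\theta]\to[-1,1]^M$ steers $x$ to $0$ along $\dot y=Ay+Bu$; $\mathcal R_t=\{T\le t\}$. The minimized Hamiltonian is $h(x,\zeta)=\langle\zeta,Ax\rangle+\min_{u\in[-1,1]^M}\langle\zeta,Bu\rangle$; an optimal trajectory of the reversed dynamics from the origin has vanishing Hamiltonian if it admits an adjoint vector $\lambda(\cdot)$ (as in Pontryagin's Maximum Principle, with terminal value a proximal normal to the sublevel set $\mathcal R_t$ at the endpoint) along which $h$ vanishes. $T$ is non-Lipschitz at $x$ if there exist sequences $x_i\to x$, $y_i\to x$, $x_i\neq y_i$, with $\limsup_i |T(y_i)-T(x_i)|/\|y_i-x_i\|=+\infty$.
   Formalization: The equivalence is stated for nonzero x̄ with T(x̄) < +∞: at boundary points of the reachable set (e.g. A=diag(1,2), b=(1,1), x̄=(1,1/2)) T blows up, so it is non-Lipschitz though x̄ is not in S, and outside its closure the difference quotient is undefined. Invariance means forward in time. *)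

(* Defs.v *)
From HB Require Import structures.
From mathcomp Require Import all_boot all_order all_algebra.
From mathcomp Require Import all_classical all_reals all_analysis.

Set Implicit Arguments.
Unset Strict Implicit.
Unset Printing Implicit Defensive.

Import Order.TTheory GRing.Theory Num.Theory.
Import numFieldNormedType.Exports.
Local Open Scope classical_set_scope.
Local Open Scope ring_scope.

Section Defs.
Variable R : realType.

Definition expm (n : nat) (A : 'M[R]_n) (t : R) : 'M[R]_n :=
  limn (series (fun k : nat => (t ^+ k / (k`!)%:R) *: (A ^+ k))).

Definition dotv (n : nat) (x y : 'cV[R]_n) : R := \sum_(j < n) x j 0 * y j 0.

Definition vint (n : nat) (a b : R) (f : R -> 'cV[R]_n) : 'cV[R]_n :=
  \col_(j < n) Rintegral lebesgue_measure `[a, b] (fun t => f t j 0).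

Definition admissible (M : nat) (theta : R) (u : R -> 'cV[R]_M) : Prop :=
  (forall j : 'I_M, measurable_fun `[0, theta] (fun t => u t j 0)) /\
  (forall t, 0 <= t <= theta -> forall j : 'I_M, -1 <= u t j 0 <= 1).

(** Solution at time θ of  y' = A y + B u,  y(0) = x  (variation of constants). *)
Definition fwd_sol (N M : nat) (A : 'M[R]_N) (B : 'M[R]_(N, M))
  (u : R -> 'cV[R]_M) (x : 'cV[R]_N) (theta : R) : 'cV[R]_N :=
  expm A theta *m x + vint 0 theta (fun s => expm A (theta - s) *m (B *m u s)).

(** Minimum time function (value +oo when the origin cannot be reached). *)
Definition min_time (N M : nat) (A : 'M[R]_N) (B : 'M[R]_(N, M))
  (x : 'cV[R]_N) : \bar R :=
  ereal_inf [set (theta%:E)%E | theta in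
    [set theta : R | 0 <= theta /\
       exists u, admissible theta u /\ fwd_sol A B u x theta = 0]].

Definition sublevel (N M : nat) (A : 'M[R]_N) (B : 'M[R]_(N, M)) (t : R)
  : set 'cV[R]_N := [set x | (min_time A B x <= t%:E)%E].

Definition non_lipschitz_at (N : nat) (f : 'cV[R]_N -> \bar R) (x : 'cV[R]_N)
  : Prop :=
  exists xs ys : nat -> 'cV[R]_N,
    xs @ \oo --> x /\ ys @ \oo --> x /\ (forall i, xs i != ys i) /\
    limn_esup (fun i => (`|f (ys i) - f (xs i)| *
                         (`|ys i - xs i|^-1)%:E)%E) = +oo%E.

Definition setS (N M : nat) (A : 'M[R]_N) (B : 'M[R]_(N, M)) : set 'cV[R]_N :=
  [set x | exists r : R, exists zeta : 'cV[R]_N,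
     0 < r /\ dotv zeta zeta = 1 /\
     x = \sum_(i < M) vint 0 r (fun t =>
            Num.sg (dotv zeta (expm A t *m col i B)) *: (expm A (t - r) *m col i B)) /\
     (forall i : 'I_M, dotv zeta (col i B) = 0)].

Definition cube (M : nat) : set 'cV[R]_M :=
  [set w | forall j : 'I_M, -1 <= w j 0 <= 1].

Definition ham_min (N M : nat) (A : 'M[R]_N) (B : 'M[R]_(N, M))
  (x zeta : 'cV[R]_N) : R :=
  dotv zeta (A *m x) + inf [set dotv zeta (B *m w) | w in @cube M].

(** Trajectory of the reversed dynamics  y' = -A y - B u,  y(0) = 0. *)
Definition rev_sol (N M : nat) (A : 'M[R]_N) (B : 'M[R]_(N, M))
  (u : R -> 'cV[R]_M) (t : R) : 'cV[R]_N :=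
  - vint 0 t (fun s => expm A (s - t) *m (B *m u s)).

Definition proximal_normal (N : nat) (K : set 'cV[R]_N) (x nu : 'cV[R]_N) : Prop :=
  exists sigma : R, 0 <= sigma /\
    forall y, K y -> dotv nu (y - x) <= sigma * dotv (y - x) (y - x).

Definition rev_optimal (N M : nat) (A : 'M[R]_N) (B : 'M[R]_(N, M))
  (theta : R) (u : R -> 'cV[R]_M) : Prop :=
  0 <= theta /\ admissible theta u /\ min_time A B (rev_sol A B u theta) = theta%:E.

(** The optimal trajectory admits an adjoint vector λ(t) = e^{A^T (t-θ)} ν
    (λ' = A^T λ, λ(θ) = ν a nonzero proximal normal to R_θ at the endpoint,
    with the minimum condition of the PMP a.e.) along which h vanishes. *)
Definition vanishing_hamiltonian (N M : nat) (A : 'M[R]_N) (B : 'M[R]_(N, M))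
  (theta : R) (u : R -> 'cV[R]_M) : Prop :=
  exists nu : 'cV[R]_N,
    nu != 0 /\
    proximal_normal (sublevel A B theta) (rev_sol A B u theta) nu /\
    let lambda := fun t => expm A^T (t - theta) *m nu in
    {ae lebesgue_measure, forall t, 0 <= t <= theta ->
       dotv (lambda t) (B *m u t) = inf [set dotv (lambda t) (B *m w) | w in @cube M]} /\
    (forall t, 0 <= t <= theta -> ham_min A B (rev_sol A B u t) (lambda t) = 0).

Definition kalman (N : nat) (A : 'M[R]_N) (b : 'cV[R]_N) : 'M[R]_N :=
  \matrix_(r < N, j < N) (A ^+ j *m b) r 0.

End Defs.

(* Main.v *)
Require Import Defs.
From HB Require Import structures.
From mathcomp Require Import all_boot all_order all_algebra.
From mathcomp Require Import all_classical all_reals all_analysis.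
From mathcomp Require Import measurable_realfun ring lra.
Set Implicit Arguments.
Unset Strict Implicit.
Unset Printing Implicit Defensive.
Import Order.TTheory GRing.Theory Num.Theory.
Import numFieldNormedType.Exports.
Local Open Scope classical_set_scope.
Local Open Scope ring_scope.

(** A point [x] is steered to the origin in time [theta] iff
    [x = - \int_0^theta e^{-As} B u(s) ds]; call [reach theta] the convex set of
    such points. Its support function is
    [supp z theta = \sum_j \int_0^theta |<z, e^{-As} b_j>| ds], attained at the
    bang-bang point [extremal z theta]. By the Kalman condition each
    [s |-> <z, e^{-As} b_j>] has countably many zeros when [z != 0], which makes
    the extremal point unique and, through the controllability Gramian, makes
    [T] continuous. In these terms [S] consists of the points [extremal z r]
    with [z != 0], [r > 0] and [<z, e^{-Ar} b_j> = 0] for all [j], i.e. those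
    for which the [theta]-derivative of [supp z] vanishes at [r].

    If [x = extremal z r] lies in [S], then [x + h z] in [reach (r + K h)] would
    give [h <z, z> <= supp z (r + K h) - supp z r = o(h)], so [T] has infinite
    slope at [x] in the direction [z].

    Conversely, let [T p - T q > K |p - q|] with [p, q] close to [x]. A unit
    vector [z] separating [p] from a slightly smaller reachable set satisfies
    [supp z theta - supp z t <= <z, p - q>] with [theta - t = (T p - T q) / 2],
    hence [\sum_j |<z, e^{-Ar} b_j>| = O(1/K)]. A limit of such [z] exhibits [x]
    as a point of [S].

    Along a trajectory with vanishing Hamiltonian, evaluating [h] at time [0]
    gives [<lambda(0), b_j> = 0], and the minimum condition identifies the
    control with [- sign <lambda(0), e^{As} b_j>] almost everywhere, so the
    whole trajectory after time [0] lies in [S]. *)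

(** * The matrix exponential *)

Section MatrixExponential.
Variables (R : realType).

(** Comparison with [D] times the exponential series at [C * |x|]. It covers the entries of the
    exponential and all their termwise derivatives. *)
Lemma cvg_pseries_fact_le (c : R^nat) (C D x : R) :
  (forall k, `|c k| <= D * (C ^+ k / k`!%:R)) -> 0 <= C -> 0 <= D ->
  cvgn (pseries c x).
Proof.
move=> cle C0 D0; apply: normed_cvg.
apply: (@series_le_cvg _ _ (fun k => D * exp_coeff (C * `|x|) k)) => [k|k|k|].
- exact: normr_ge0.
- by rewrite mulr_ge0// exp_coeff_ge0// mulr_ge0.
- rewrite /= normrM normrX /exp_coeff/= exprMn.
  rewrite (mulrAC (C ^+ k)) mulrA ler_wpM2r ?exprn_ge0//.
- by apply: is_cvg_seriesZ; exact: is_cvg_series_exp_coeff.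
Qed.

Lemma cvg_mx_coord (n m : nat) (f : nat -> 'M[R]_(n, m)) (l : 'M[R]_(n, m)) :
  (forall i j, (fun k => f k i j) @ \oo --> l i j) -> f @ \oo --> l.
Proof.
move=> H; apply/cvgrPdist_le => e e0; near=> k.
rewrite /Num.Def.normr/= mx_normrE (bigmax_le _ (ltW e0))//= => i _.
rewrite !mxE/=; move: i; near: k; apply: filter_forall => /= i.
exact: ((cvgrPdist_le _ _).1 (H i.1 i.2)).
Unshelve. all: by end_near. Qed.

Lemma cvg_big_sum (n : nat) (f : 'I_n -> R^nat) (a : 'I_n -> R) :
  (forall l, f l @ \oo --> a l) ->
  (fun k => \sum_l f l k) @ \oo --> \sum_l a l.
Proof.
move=> fa; rewrite (_ : (fun k => _) = \sum_l f l); last first.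
  by apply/funext => k; rewrite fct_sumE.
elim/big_ind2 : _ => [|g1 b1 g2 b2 H1 H2|l _]; [exact: cvg_cst| |exact: fa].
exact: cvgD.
Qed.

Variables (n : nat).
Implicit Types A : 'M[R]_n.

(** The sum of the moduli of all entries dominates every row sum, so each further factor [A] costs
    at most this sum. *)
Lemma norm_expr_mx_le A k i j :
  `|(A ^+ k) i j| <= (\sum_i \sum_j `|A i j|) ^+ k.
Proof.
elim: k i j => [|k IH] i j.
  by rewrite !expr0 mxE; case: (i == j); rewrite ?normr1 ?normr0.
rewrite exprS mxE (le_trans (ler_norm_sum _ _ _))//.
apply: (@le_trans _ _ (\sum_l `|A i l| * (\sum_i \sum_j `|A i j|) ^+ k)).
  by apply: ler_sum => l _; rewrite normrM ler_wpM2l.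
rewrite -mulr_suml exprS ler_wpM2r//.
  by rewrite exprn_ge0// sumr_ge0// => ? _; rewrite sumr_ge0.
rewrite [leRHS](bigD1 i)//= lerDl sumr_ge0// => ? _; by rewrite sumr_ge0.
Qed.

(** Power series coefficients of an entry of [A ^+ p *m expm A t]. With the shift [p], formal
    differentiation is just the passage from [p] to [p.+1]. *)
Let c A p i j : R^nat := fun k => (A ^+ (k + p)) i j / k`!%:R.

Let cvg_c A p i j x : cvgn (pseries (c A p i j) x).
Proof.
set C := \sum_i \sum_j `|A i j|.
have C0 : 0 <= C by rewrite sumr_ge0// => ? _; rewrite sumr_ge0.
apply: (@cvg_pseries_fact_le _ C (C ^+ p)) => //; last by rewrite exprn_ge0.
move=> k; rewrite /c normrM normfV (ger0_norm (ler0n _ _)) mulrA.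
by rewrite ler_wpM2r ?invr_ge0// -exprD addnC norm_expr_mx_le.
Qed.

Let diffs_c A p i j : pseries_diffs (c A p i j) = c A p.+1 i j.
Proof.
apply/funext => k; rewrite /pseries_diffs /c factS natrM addSn addnS.
by rewrite invfM mulrCA [_%:R * _]mulrA divff ?mul1r// pnatr_eq0.
Qed.

Lemma expmE A t i j :
  expm A t i j = limn (pseries (fun k => (A ^+ k) i j / k`!%:R) t).
Proof.
have E k : (fun k => (A ^+ k) i j / k`!%:R) k = c A 0 i j k by rewrite /c addn0.
rewrite (_ : (fun k => _) = c A 0 i j); last exact/funext.
rewrite /expm; set f := series _.
suff -> : limn f = \matrix_(i, j) limn (pseries (c A 0 i j) t) by rewrite mxE.
apply/cvg_lim => //; apply: cvg_mx_coord => a b; rewrite mxE.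
rewrite (_ : (fun k => f k a b) = pseries (c A 0 a b) t); first exact: cvg_c.
apply/funext => k; rewrite /f /series /= summxE; apply: eq_bigr => l _.
by rewrite mxE /= /c addn0; ring.
Qed.

Lemma is_derive_expm A (t : R) i j :
  is_derive t (1 : R) (fun t => expm A t i j) ((A *m expm A t) i j).
Proof.
have E a b : (fun k => (A ^+ k) a b / k`!%:R) = c A 0 a b.
  by apply/funext => k; rewrite /c addn0.
have -> : (fun t => expm A t i j) = (fun t => limn (pseries (c A 0 i j) t)).
  by apply/funext => x; rewrite expmE E.
have -> : (A *m expm A t) i j = limn (pseries (c A 1 i j) t).
  rewrite mxE; apply/esym/cvg_lim => //.
  under eq_bigr do rewrite expmE E.
  have -> : pseries (c A 1 i j) t =
      (fun k => \sum_l A i l * pseries (c A 0 l j) t k).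
    apply/funext => k; rewrite /pseries /series /=.
    under [RHS]eq_bigr do rewrite mulr_sumr.
    rewrite exchange_big/=; apply: eq_bigr => q _.
    rewrite /c addn1 addn0 exprS mxE !mulr_suml.
    by apply: eq_bigr => l _; rewrite !mulrA.
  apply: cvg_big_sum => l; apply: cvgM; [exact: cvg_cst|exact: cvg_c].
(* Differentiation under the sum asks for a point strictly beyond [|t|] at which the series and its
   first two formal derivatives converge. *)
rewrite -diffs_c; apply: (@pseries_snd_diffs _ _ (`|t| + 1)).
- exact: cvg_c.
- by rewrite diffs_c; exact: cvg_c.
- by rewrite !diffs_c; exact: cvg_c.
- by rewrite ltr_normr ltrDl ltr01.
Qed.

Lemma expm_comm A t : A *m expm A t = expm A t *m A.
Proof.
apply/matrixP => i j; rewrite !mxE.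
have L a b : pseries (fun k => (A ^+ k) a b / k`!%:R) t @ \oo -->
    expm A t a b.
  rewrite expmE (_ : (fun k => _) = c A 0 a b); first exact: cvg_c.
  by apply/funext => k; rewrite /c addn0.
have H1 : (fun k => \sum_l A i l *
    pseries (fun k => (A ^+ k) l j / k`!%:R) t k) @ \oo
    --> \sum_l A i l * expm A t l j.
  by apply: cvg_big_sum => l; apply: cvgM; [exact: cvg_cst|exact: L].
have H2 : (fun k => \sum_l
    pseries (fun k => (A ^+ k) i l / k`!%:R) t k * A l j) @ \oo
    --> \sum_l expm A t i l * A l j.
  by apply: cvg_big_sum => l; apply: cvgM; [exact: L|exact: cvg_cst].
suff E : (fun k => \sum_l A i l *
    pseries (fun k => (A ^+ k) l j / k`!%:R) t k) = (fun k => \sum_l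
    pseries (fun k => (A ^+ k) i l / k`!%:R) t k * A l j).
  by rewrite E in H1; exact: (cvg_unique _ H1 H2).
apply/funext => k; rewrite /pseries /series /=.
under eq_bigr do rewrite mulr_sumr.
under [RHS]eq_bigr do rewrite mulr_suml.
rewrite exchange_big/= [RHS]exchange_big/=; apply: eq_bigr => q _.
have : (A * A ^+ q) i j = (A ^+ q * A) i j by rewrite -exprS -exprSr.
rewrite !mxE => /(congr1 (fun x => x / q`!%:R * t ^+ q)).
rewrite !mulr_suml => E; transitivity (\sum_l A i l * (A ^+ q) l j / q`!%:R * t ^+ q).
  by apply: eq_bigr => l _; rewrite !mulrA.
by rewrite E; apply: eq_bigr => l _; ring.
Qed.

Lemma expm0 A : expm A 0 = 1%:M.
Proof.
apply/matrixP => i j; rewrite expmE.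
apply/cvg_lim => //; apply: (@cvg_near_cst _ _ _ _ _ _ _).
near=> k; rewrite /pseries /series /=.
have /prednK <- : (0 < k)%N by near: k; exists 1%N.
rewrite big_nat_recl//= big1 => [|l _]; last by rewrite expr0n mulr0.
by rewrite addr0 !expr0 fact0 divr1 mulr1.
Unshelve. all: by end_near. Qed.

(** The product [expm A (s + t - x) *m expm A x] has zero derivative in [x] because [A] commutes
    with its exponential. Its values at [0] and [t] are the two sides. *)
Lemma expmD A s t : expm A (s + t) = expm A s *m expm A t.
Proof.
pose F x := expm A (s + t - x) *m expm A x.
suff H x y : F x = F y.
  by have := H 0 t; rewrite /F subr0 expm0 mulmx1 addrK => ->.
apply/matrixP => i j.
apply: (@is_derive_0_is_cst _ (fun x => F x i j)) => z {x y}.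
have -> : (fun x => F x i j) =
    \sum_l (fun x => expm A (s + t - x) i l * expm A x l j).
  by apply/funext => x; rewrite fct_sumE /F mxE.
pose E := expm A (s + t - z).
pose d l : R := E i l * (A *m expm A z) l j + expm A z l j * (- (A *m E) i l).
have -> : 0 = \sum_l d l.
  rewrite /d big_split/=; under [X in _ + X]eq_bigr do rewrite mulrN [X in - X]mulrC.
  have := congr1 (fun M : 'M[R]_n => M i j) (mulmxA E A (expm A z)).
  by rewrite -expm_comm !mxE sumrN => ->; rewrite subrr.
apply: is_derive_sum => l.
have D1 : is_derive z (1 : R) (fun x => expm A (s + t - x) i l) (- (A *m E) i l).
  have H := is_derive_expm A (s + t - z) i l.
  have Hb : is_derive z (1 : R) (fun x => s + t - x) (-1).
    by apply: is_derive_eq; rewrite add0r mul1r.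
  have := @is_derive1_comp _ (fun t => expm A t i l) (fun x => s + t - x) z _ _ H Hb.
  by rewrite mulrN1.
have D2 := is_derive_expm A z l j.
rewrite /d; have := is_deriveM D1 D2.
by rewrite /GRing.scale/=.
Qed.

Lemma expmNK A t : expm A t *m expm A (- t) = 1%:M.
Proof. by rewrite -expmD subrr expm0. Qed.

Lemma expmKN A t : expm A (- t) *m expm A t = 1%:M.
Proof. by rewrite -expmD addNr expm0. Qed.

Lemma expm_tr A t : expm A^T t = (expm A t)^T.
Proof.
apply/matrixP => i j; rewrite mxE !expmE; congr (limn (pseries _ t)).
apply/funext => k; congr (_ / _); rewrite -[RHS](mxE trmx_key (fun i j => (A ^+ k) j i)).
elim: k i j => [|k IH] i j; first by rewrite !expr0 !mxE eq_sym.
by rewrite exprS exprSr !mxE; apply: eq_bigr => l _; rewrite mulrC mxE IH mxE.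
Qed.

End MatrixExponential.

(** * The Euclidean product and its comparison with the sup norm *)

Section DotProduct.
Variables (R : realType).

Lemma dotvE n (x y : 'cV[R]_n) : dotv x y = (x^T *m y) 0 0.
Proof. by rewrite mxE; apply: eq_bigr => j _; rewrite mxE. Qed.

Lemma dotvC n (x y : 'cV[R]_n) : dotv x y = dotv y x.
Proof. by apply: eq_bigr => j _; rewrite mulrC. Qed.

Lemma dotvDr n (x y z : 'cV[R]_n) : dotv x (y + z) = dotv x y + dotv x z.
Proof. by rewrite !dotvE mulmxDr mxE. Qed.

Lemma dotvDl n (x y z : 'cV[R]_n) : dotv (x + y) z = dotv x z + dotv y z.
Proof. by rewrite dotvC dotvDr !(dotvC z). Qed.

Lemma dotvNr n (x y : 'cV[R]_n) : dotv x (- y) = - dotv x y.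
Proof. by rewrite !dotvE mulmxN mxE. Qed.

Lemma dotvNl n (x y : 'cV[R]_n) : dotv (- x) y = - dotv x y.
Proof. by rewrite dotvC dotvNr dotvC. Qed.

Lemma dotvBr n (x y z : 'cV[R]_n) : dotv x (y - z) = dotv x y - dotv x z.
Proof. by rewrite dotvDr dotvNr. Qed.

Lemma dotvBl n (x y z : 'cV[R]_n) : dotv (x - y) z = dotv x z - dotv y z.
Proof. by rewrite dotvDl dotvNl. Qed.

Lemma dotvZr n a (x y : 'cV[R]_n) : dotv x (a *: y) = a * dotv x y.
Proof. by rewrite !dotvE -scalemxAr mxE. Qed.

Lemma dotvZl n a (x y : 'cV[R]_n) : dotv (a *: x) y = a * dotv x y.
Proof. by rewrite dotvC dotvZr dotvC. Qed.

Lemma dotv0r n (x : 'cV[R]_n) : dotv x 0 = 0.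
Proof. by rewrite dotvE mulmx0 mxE. Qed.

Lemma dotv0l n (x : 'cV[R]_n) : dotv 0 x = 0.
Proof. by rewrite dotvC dotv0r. Qed.

Lemma dotv_sumr n (I : finType) (x : 'cV[R]_n) (F : I -> 'cV[R]_n) :
  dotv x (\sum_i F i) = \sum_i dotv x (F i).
Proof. by rewrite dotvE mulmx_sumr summxE; apply: eq_bigr => i _; rewrite dotvE. Qed.

Lemma dotv_mulmx n m (C : 'M[R]_(n, m)) (x : 'cV[R]_n) (y : 'cV[R]_m) :
  dotv x (C *m y) = dotv (C^T *m x) y.
Proof. by rewrite !dotvE trmx_mul trmxK mulmxA. Qed.

Lemma dotv_ge0 n (x : 'cV[R]_n) : 0 <= dotv x x.
Proof. by apply: sumr_ge0 => j _; rewrite -expr2 sqr_ge0. Qed.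

Lemma dotv_eq0 n (x : 'cV[R]_n) : (dotv x x == 0) = (x == 0).
Proof.
apply/idP/eqP => [|->]; last by rewrite dotv0l eqxx.
rewrite psumr_eq0 => [/allP H|j _]; last by rewrite -expr2 sqr_ge0.
apply/colP => j; rewrite mxE; apply/eqP.
by have := H j (mem_index_enum _); rewrite -expr2 sqrf_eq0.
Qed.

Lemma dotv_gt0 n (x : 'cV[R]_n) : x != 0 -> 0 < dotv x x.
Proof. by rewrite lt_def dotv_eq0 dotv_ge0 andbT. Qed.

Lemma norm_coord_le n m (x : 'M[R]_(n, m)) i j : `|x i j| <= `|x|.
Proof.
rewrite [leRHS]/Num.Def.normr/= mx_normrE.
exact: (le_bigmax _ (fun ij : 'I_n * 'I_m => `|x ij.1 ij.2|) (i, j)).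
Qed.

Lemma mx_norm_le n m (x : 'M[R]_(n, m)) C :
  0 <= C -> (forall i j, `|x i j| <= C) -> `|x| <= C.
Proof.
move=> C0 xC; rewrite [leLHS]/Num.Def.normr/= mx_normrE.
by apply: bigmax_le => // -[i j] _ /=.
Qed.

(** The norm is the largest modulus of an entry, whence the factor [n] in this form of
    Cauchy-Schwarz. *)
Lemma dotv_norm_le n (x y : 'cV[R]_n) : `|dotv x y| <= n%:R * `|x| * `|y|.
Proof.
rewrite (le_trans (ler_norm_sum _ _ _))//.
apply: (@le_trans _ _ (\sum_(j < n) `|x| * `|y|)).
  by apply: ler_sum => j _; rewrite normrM ler_pM// norm_coord_le.
by rewrite sumr_const card_ord -[leLHS]mulr_natl mulrA.
Qed.

Lemma norm_sqr_le_dotv n (x : 'cV[R]_n) : `|x| ^+ 2 <= dotv x x.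
Proof.
have [->|x0] := eqVneq x 0; first by rewrite normr0 expr0n/= dotv_ge0.
have /mx_norm_neq0[[i j] /= E] : mx_norm x != 0 by rewrite -normr_eq0 in x0.
rewrite [`|x|]E real_normK ?num_real// (ord1 j) /dotv (bigD1 i)//= expr2 lerDl.
by apply: sumr_ge0 => k _; rewrite -expr2 sqr_ge0.
Qed.

End DotProduct.

(** * Countability of the zeros of [<z, e^{At} b>] *)

Section Zeros.
Variables (R : realType).

(** Near a zero with nonzero derivative the difference quotient does not vanish, so these zeros are
    isolated points of their set, and a set of reals has countably many isolated points. *)
Lemma countable_simple_zeros (f df : R -> R) :
  (forall t : R, is_derive t (1 : R) f (df t)) ->
  countable [set t | f t = 0 /\ df t != 0].
Proof.
move=> fdf; set S := [set t | _].
apply: (@sub_countable _ _ _ (isolated S)); last exact: countable_isolated.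
apply: subset_card_le => t St; split; first exact/mem_set.
have [ft0 dft] := St; have [H E] := fdf t; rewrite -E in dft.
have {}H : h^-1 *: (f (h *: 1 + t) - f t) @[h --> 0^'] --> 'D_1 f t by [].
have := cvgr_neq0 _ H dft.
case=> e /= e0 He.
exists (ball t e); first exact: nbhsx_ballx.
apply/seteqP; split=> [s [tse [fs0 _]]|_ ->]; last by split=> //; exact: ballxx.
apply/eqP/negPn/negP => st.
have := He (s - t); rewrite /ball_/= sub0r opprB.
move=> /(_ tse); rewrite subr_eq0 => /(_ st).
by rewrite [(s - t)%:A]mulr1 subrK fs0 ft0 subrr scaler0 eqxx.
Qed.

Variables (n : nat) (A : 'M[R]_n).

Lemma is_derive_dotv_expm (z b : 'cV[R]_n) (t : R) :
  is_derive t (1 : R) (fun t => dotv z (expm A t *m b))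
    (dotv z (expm A t *m (A *m b))).
Proof.
have -> : (fun t => dotv z (expm A t *m b)) =
    \sum_i \sum_j (fun t => (z i 0 * b j 0) *: expm A t i j).
  apply/funext => x; rewrite fct_sumE; apply: eq_bigr => i _.
  rewrite fct_sumE mxE mulr_sumr; apply: eq_bigr => j _.
  by rewrite /GRing.scale/=; ring.
have -> : dotv z (expm A t *m (A *m b)) =
    \sum_i \sum_j (z i 0 * b j 0) *: (A *m expm A t) i j.
  rewrite mulmxA -expm_comm; apply: eq_bigr => i _.
  rewrite mxE mulr_sumr; apply: eq_bigr => j _.
  by rewrite /GRing.scale/=; ring.
apply: is_derive_sum => i; apply: is_derive_sum => j.
by apply: is_deriveZ; exact: is_derive_expm.
Qed.

Lemma continuous_dotv_expm (z b : 'cV[R]_n) :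
  continuous (fun t => dotv z (expm A t *m b)).
Proof.
move=> t; apply/differentiable_continuous/derivable1_diffP.
by have [] := is_derive_dotv_expm z b t.
Qed.

Lemma kalman_dotv_eq0 (b w : 'cV[R]_n) : \rank (kalman A b) = n ->
  (forall k, (k < n)%N -> dotv w (A ^+ k *m b) = 0) -> w = 0.
Proof.
move=> rk H.
have /row_free_inj inj : row_free (kalman A b) by rewrite /row_free rk.
apply: trmx_inj; apply: inj; rewrite trmx0 mul0mx.
apply/rowP => j; rewrite !mxE -[RHS](H j (ltn_ord j)).
by apply: eq_bigr => i _; rewrite !mxE.
Qed.

(* Every point of the zero set is a simple zero of some derivative of order
   less than [n], since otherwise the Kalman condition would force [z = 0]. *)
Lemma countable_zeros_dotv_expm (z b : 'cV[R]_n) :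
  \rank (kalman A b) = n -> z != 0 ->
  countable [set t | dotv z (expm A t *m b) = 0].
Proof.
move=> rk z0; pose g k t := dotv z (expm A t *m (A ^+ k *m b)).
apply: (@sub_countable _ _ _
  (\bigcup_(k in [set: nat]) [set t | g k t = 0 /\ g k.+1 t != 0])).
  apply: subset_card_le => t /= gt0; apply: contrapT => H.
  have {}H k : g k t = 0.
    elim: k => [|k IH]; first by rewrite /g expr0 mul1mx.
    apply/eqP/negPn/negP => gk; apply: H; exists k => //.
  have /(kalman_dotv_eq0 rk) : forall k, (k < n)%N ->
      dotv ((expm A t)^T *m z) (A ^+ k *m b) = 0.
    by move=> k _; rewrite -dotv_mulmx; exact: H.
  move=> /(congr1 (mulmx (expm A (- t))^T)).
  rewrite mulmxA -trmx_mul expmNK trmx1 mul1mx mulmx0 => z00.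
  by rewrite z00 eqxx in z0.
apply: bigcup_countable => // k _.
apply: countable_simple_zeros => t; rewrite /g exprS -mulmxA.
exact: is_derive_dotv_expm.
Qed.

End Zeros.

(** * Integration of bounded measurable functions on a segment *)

Section BoundedMeasurable.
Variable R : realType.
Local Notation mu := (@lebesgue_measure R).
Local Notation I a b f := (Rintegral mu `[a, b] f).
Implicit Types (a b c r : R) (f g : R -> R).

(** The working class of integrands: integrable on the segment, and closed under sums, products,
    moduli and signs. *)
Definition bmeas a b f := measurable_fun `[a, b] f /\
  exists C : R, forall t, a <= t <= b -> `|f t| <= C.

Lemma bmeas_integrable a b f : bmeas a b f -> mu.-integrable `[a, b] (EFin \o f).
Proof.
move=> [mf [C fC]]; apply: measurable_bounded_integrable => //.
- by rewrite /= lebesgue_measure_itv/=; case: ifP => // _; exact: ltry.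
- exists C; split; first exact: num_real.
  move=> y Cy t /=; rewrite in_itv/= => /fC /le_trans; apply; exact: ltW.
Qed.

Lemma bmeas_eq a b f g : (forall t, a <= t <= b -> f t = g t) ->
  bmeas a b f -> bmeas a b g.
Proof.
move=> fg [mf [C fC]]; split.
  apply: eq_measurable_fun mf => t; rewrite inE/= in_itv/=; exact: fg.
by exists C => t tab; rewrite -fg// fC.
Qed.

Lemma bmeas_cst a b c : bmeas a b (fun=> c).
Proof. by split; [exact: measurable_cst|exists `|c|]. Qed.

Lemma bmeas_continuous a b f : continuous f -> bmeas a b f.
Proof.
move=> cf; split; first by apply: measurable_funTS; exact: continuous_measurable_fun.
have /compact_bounded[C [_ HC]] : compact (f @` `[a, b]).
  apply: continuous_compact; last exact: segment_compact.
  exact: continuous_subspaceT.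
exists (C + 1) => t tab; apply: HC; rewrite ?ltrDl//=.
by exists t => //=; rewrite in_itv.
Qed.

Lemma bmeasD a b f g : bmeas a b f -> bmeas a b g ->
  bmeas a b (fun t => f t + g t).
Proof.
move=> [mf [C fC]] [mg [D gD]]; split; first exact: measurable_funD.
by exists (C + D) => t tab; rewrite (le_trans (ler_normD _ _))// lerD// ?fC ?gD.
Qed.

Lemma bmeasM a b f g : bmeas a b f -> bmeas a b g ->
  bmeas a b (fun t => f t * g t).
Proof.
move=> [mf [C fC]] [mg [D gD]]; split; first exact: measurable_funM.
by exists (C * D) => t tab; rewrite normrM ler_pM// ?fC ?gD.
Qed.

Lemma bmeasZ a b c f : bmeas a b f -> bmeas a b (fun t => c * f t).
Proof. by move=> bf; apply: bmeasM => //; exact: bmeas_cst. Qed.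

Lemma bmeasN a b f : bmeas a b f -> bmeas a b (fun t => - f t).
Proof.
by move=> bf; apply: bmeas_eq (bmeasZ (-1) bf) => t _; rewrite mulN1r.
Qed.

Lemma bmeasB a b f g : bmeas a b f -> bmeas a b g ->
  bmeas a b (fun t => f t - g t).
Proof. by move=> bf bg; apply: bmeasD => //; exact: bmeasN. Qed.

Lemma bmeas_sum a b (J : finType) (F : J -> R -> R) :
  (forall j, bmeas a b (F j)) -> bmeas a b (fun t => \sum_j F j t).
Proof.
move=> bF; rewrite (_ : (fun t => _) = \sum_j F j); last first.
  by apply/funext => t; rewrite fct_sumE.
apply: big_ind => [|f g bf bg|j _]; [exact: bmeas_cst|exact: bmeasD|exact: bF].
Qed.

Lemma bmeas_norm a b f : bmeas a b f -> bmeas a b (fun t => `|f t|).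
Proof.
move=> [mf [C fC]]; split; first exact: measurableT_comp.
by exists C => t tab; rewrite normr_id fC.
Qed.

Lemma bmeas_sg a b f : measurable_fun `[a, b] f ->
  bmeas a b (fun t => Num.sg (f t)).
Proof.
move=> mf; split; last first.
  by exists 1 => t _; rewrite normr_sg lern1 leq_b1.
apply: measurableT_comp mf; apply: nondecreasing_measurable => // x y xy.
case: (sgrP y) => y0.
- by rewrite y0 in xy; rewrite sgr_le0.
- by have := lexx (1 : R); case: (sgrP x) => //; lra.
- by rewrite ltr0_sg// (le_lt_trans xy).
Qed.

Lemma bmeasS a b c d f : a <= c -> d <= b -> bmeas a b f -> bmeas c d f.
Proof.
move=> ac db [mf [C fC]]; split.
  apply: measurable_funS mf => // t /=; rewrite !in_itv/= => /andP[ct td].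
  by rewrite (le_trans ac)// (le_trans td).
by exists C => t /andP[ct td]; rewrite fC// (le_trans ac)// (le_trans td).
Qed.

Lemma intD a b f g : bmeas a b f -> bmeas a b g ->
  I a b (fun t => f t + g t) = I a b f + I a b g.
Proof. by move=> bf bg; rewrite RintegralD//; exact: bmeas_integrable. Qed.

Lemma intB a b f g : bmeas a b f -> bmeas a b g ->
  I a b (fun t => f t - g t) = I a b f - I a b g.
Proof. by move=> bf bg; rewrite RintegralB//; exact: bmeas_integrable. Qed.

Lemma intZ a b c f : bmeas a b f -> I a b (fun t => c * f t) = c * I a b f.
Proof. by move=> bf; rewrite RintegralZl//; exact: bmeas_integrable. Qed.

Lemma int_eq a b f g : (forall t, a <= t <= b -> f t = g t) ->
  I a b f = I a b g.
Proof.
by move=> fg; apply: eq_Rintegral => t; rewrite inE/= in_itv/=; exact: fg.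
Qed.

Lemma intN a b f : bmeas a b f -> I a b (fun t => - f t) = - I a b f.
Proof.
by move=> bf; rewrite -mulN1r -intZ//; apply: int_eq => t _; rewrite mulN1r.
Qed.

Lemma int_cst a b c : a <= b -> I a b (fun=> c) = c * (b - a).
Proof.
move=> ab; rewrite Rintegral_cst//= lebesgue_measure_itv/= lte_fin.
case: ltP => //= ba; have -> : b = a by apply/eqP; rewrite eq_le ab ba.
by rewrite subrr.
Qed.

Lemma int_sum a b (J : finType) (F : J -> R -> R) :
  (forall j, bmeas a b (F j)) ->
  I a b (fun t => \sum_j F j t) = \sum_j I a b (F j).
Proof.
move=> bF; rewrite (_ : (fun t => _) = \sum_j F j); last first.
  by apply/funext => t; rewrite fct_sumE.
suff: bmeas a b (\sum_j F j) /\ I a b (\sum_j F j) = \sum_j I a b (F j) by case.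
elim/big_ind2 : _ => [|f x g y [bf <-] [bg <-]|j _]; last by [].
- split; first exact: bmeas_cst.
  by rewrite /Rintegral/= integral0_eq.
- by split; [exact: bmeasD|exact: intD].
Qed.

Lemma int_le a b f g : bmeas a b f -> bmeas a b g ->
  (forall t, a <= t <= b -> f t <= g t) -> I a b f <= I a b g.
Proof.
move=> bf bg fg; by apply: le_Rintegral => //; exact: bmeas_integrable.
Qed.

Lemma int_ge0 a b f : (forall t, a <= t <= b -> 0 <= f t) -> 0 <= I a b f.
Proof. by move=> f0; apply: Rintegral_ge0 => t /=; rewrite in_itv/=; exact: f0. Qed.

Lemma int_norm_le a b f : bmeas a b f -> `|I a b f| <= I a b (fun t => `|f t|).
Proof. by move=> bf; apply: le_normr_Rintegral => //; exact: bmeas_integrable. Qed.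

Lemma int_norm_le_cst a b c f : a <= b -> bmeas a b f ->
  (forall t, a <= t <= b -> `|f t| <= c) -> `|I a b f| <= c * (b - a).
Proof.
move=> ab bf fc; rewrite (le_trans (int_norm_le bf))// -int_cst//.
by apply: int_le => //; [exact: bmeas_norm|exact: bmeas_cst].
Qed.

Lemma int_chasles a b c f : a <= b -> b <= c -> bmeas a c f ->
  I a c f = I a b f + I b c f.
Proof.
move=> ab bc bf; have := @Rintegral_itvB _ f (BLeft a) (BRight c) b.
move=> /(_ (bmeas_integrable bf)); rewrite !bnd_simp => /(_ ab bc).
rewrite Rintegral_itv_obnd_cbnd; first by move=> <-; rewrite addrC subrK.
apply: integrableS (bmeas_integrable bf) => //.
move=> t /=; rewrite !in_itv/= => /andP[bt ->]; rewrite andbT.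
by rewrite (le_trans ab)// ltW.
Qed.

Lemma int_ae_eq a b f g : bmeas a b f -> bmeas a b g ->
  {ae mu, forall t, a <= t <= b -> f t = g t} -> I a b f = I a b g.
Proof.
move=> bf bg fg; congr fine; apply: ae_eq_integral => //.
- by apply/measurable_EFinP; exact: bf.1.
- by apply/measurable_EFinP; exact: bg.1.
- case: fg => S [mS S0 sub]; exists S; split=> // t Ht; apply: sub => H.
  by apply: Ht => /=; rewrite in_itv/= => /H ->.
Qed.

Lemma countable_ae (S : set R) : countable S -> {ae mu, forall t, ~ S t}.
Proof.
move=> cS; exists S; split => //.
- by apply: countable_measurable => //; exact: measurable_set1.
- exact: countable_lebesgue_measure0.
- by move=> t /= /contrapT.
Qed.

Lemma bmeas_reflect r f : bmeas 0 r f -> bmeas 0 r (fun t => f (r - t)).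
Proof.
have H t : 0 <= t <= r -> 0 <= r - t <= r by lra.
move=> [mf [C fC]]; split; last by exists C => t /H /fC.
apply: (@measurable_comp _ _ _ _ _ _ `[0, r]) mf _ => //.
  by move=> _ [t /=] + <-; rewrite !in_itv/= => /H.
exact: measurable_funB.
Qed.

Let refl r : R -> measurableTypeR R := fun t => r - t.

Let measurable_refl r : measurable_fun [set: R] (refl r).
Proof. exact: measurable_funB. Qed.

Let preimage_refl r a b : refl r @^-1` `[a, b] = `[r - b, r - a]%classic.
Proof.
by apply/seteqP; split=> t /=; rewrite !in_itv/= /refl; lra.
Qed.

(** The preimage of []a, b]] is [[r - b, r - a[], of equal length, and Lebesgue measure is
    determined by its values on such intervals. *)
Lemma lebesgue_measure_reflect r (S : set R) : measurable S ->
  pushforward mu (refl r) S = mu S.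
Proof.
move=> mS; apply/esym/lebesgue_measure_unique => //=; first exact: measurable_refl.
  move=> _ _ [[a b]] _ <-.
  rewrite /pushforward (_ : _ @^-1` _ = `[r - b, r - a[%classic).
    rewrite !lebesgue_measure_itv/= !lte_fin ltrD2l ltrN2.
    by case: ifP => // _; rewrite -!EFinB; congr EFin; lra.
  by apply/seteqP; split=> t /=; rewrite !in_itv/= /refl; lra.
Qed.

Lemma int_reflect r f : bmeas 0 r f -> I 0 r f = I 0 r (fun t => f (r - t)).
Proof.
(* Extended by zero, the integrand is measurable on the whole line, as the change of variables asks;
   [[0, r]] is its own preimage. *)
move=> bf; congr fine; pose g := (EFin \o f) \_ `[0, r].
have -> : (\int[mu]_(t in `[0%R, r]) (f t)%:E =
          \int[mu]_(t in `[0%R, r]) g t)%E.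
  by apply: eq_integral => t tr; rewrite /g /restrict tr.
have D : `[0, r]%classic = refl r @^-1` `[0, r].
  by rewrite preimage_refl subrr subr0.
have -> : (\int[mu]_(t in `[0%R, r]) (f (r - t)%R)%:E =
          \int[mu]_(t in refl r @^-1` `[0%R, r]) (g \o refl r) t)%E.
  rewrite -D; apply: eq_integral => t; rewrite D => /set_mem tr.
  by rewrite /= /g /restrict mem_set.
rewrite -integral_pushforward//=.
- apply: eq_measure_integral => //=; first exact: measurable_refl.
  by move=> _ S mS _; rewrite lebesgue_measure_reflect.
- exact: measurable_refl.
- have mf : measurable_fun `[0, r] (EFin \o f) by apply/measurable_EFinP; exact: bf.1.
  exact: (measurable_restrictT _ _).1 mf.
- rewrite -D; have := bmeas_integrable (bmeas_reflect bf).
  apply: eq_integrable => // t; rewrite D => /set_mem tr.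
  by rewrite /= /g /restrict mem_set.
Qed.

End BoundedMeasurable.

(** * Integrals of functions with countably many zeros *)

Section IntegralZeros.
Variable R : realType.
Local Notation mu := (@lebesgue_measure R).
Local Notation I a b f := (Rintegral mu `[a, b] f).

Lemma bmeas_max (a b : R) f g : bmeas a b f -> bmeas a b g ->
  bmeas a b (fun t => Num.max (f t) (g t)).
Proof.
move=> [mf [C fC]] [mg [D gD]]; split; first exact: measurable_maxr.
exists (C + D) => t tab; have Ct := fC _ tab; have Dt := gD _ tab.
have := normr_ge0 (f t); have := normr_ge0 (g t).
by case: (leP (f t) (g t)) => _; lra.
Qed.

(** The functions [max 0 (1 - n |f|)] lie between 0 and 1 and tend to 0 off the null set of zeros of
    [f], so dominated convergence applies. The result measures how little time [|f|] spends below
    [1 / K]. *)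
Lemma int_tent_small (a b e : R) f : bmeas a b f -> countable [set t | f t = 0] ->
  0 < e -> exists2 K, 0 <= K & I a b (fun t => Num.max 0 (1 - K * `|f t|)) < e.
Proof.
move=> bf cf e0; pose h (n : nat) t : R := Num.max 0 (1 - n%:R * `|f t|).
have bh n : bmeas a b (h n).
  apply: bmeas_max; first exact: bmeas_cst.
  by apply: bmeasB; [exact: bmeas_cst|apply: bmeasZ; exact: bmeas_norm].
have h01 n t : 0 <= h n t <= 1.
  rewrite /h; have : 0 <= n%:R * `|f t| by rewrite mulr_ge0.
  by rewrite le_max lexx/= ge_max ler01/=; lra.
have mh n : measurable_fun `[a, b] (EFin \o h n).
  by apply/measurable_EFinP; exact: (bh n).1.
have [|||_ _ H] := @dominated_convergence _ _ _ mu `[a, b] (measurable_itv _)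
  (fun n => EFin \o h n) (cst 0%E) (cst 1%E) mh (measurable_cst _).
- have [S [mS S0 sub]] := countable_ae cf.
  exists S; split=> // t Ht; apply: sub => ft; apply: Ht => _.
  apply: cvg_near_cst; near=> n => /=; congr EFin.
  have f0 : 0 < `|f t| by rewrite normr_gt0; apply/eqP.
  have : `|f t|^-1 <= n%:R by near: n; exact: nbhs_infty_ger.
  rewrite -(ler_pM2r f0) mulVf ?gt_eqF// => ?.
  by rewrite /h; apply/max_idPl; rewrite subr_le0.
- exact: (bmeas_integrable (bmeas_cst a b 1)).
- apply: aeW => t n _ /=; have /andP[h0 h1] := h01 n t.
  by rewrite lee_fin ger0_norm.
have {}H : (fun n => I a b (h n)) @ \oo --> (0 : R).
  have -> : (0 : R) = fine (\int[mu]_(x in `[a, b]) cst 0 x)%E.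
    by rewrite integral0.
  apply: fine_cvg; rewrite fineK ?integral0//.
  by rewrite integral0 in H.
have := (cvgrPdist_lt _ _).1 H _ e0.
move=> [n _ /(_ n (leqnn _))]; rewrite /= sub0r normrN => Hn.
exists n%:R => //; apply: le_lt_trans Hn; exact: ler_norm.
Unshelve. all: by end_near. Qed.

(** With [K] taken from [int_tent_small], the integral of [1 - K * f] is below [(b - a) / 2], so [K]
    times the integral of [f] exceeds [(b - a) / 2]. *)
Lemma int_gt0 (a b : R) f : a < b -> bmeas a b f -> countable [set t | f t = 0] ->
  (forall t, a <= t <= b -> 0 <= f t) -> 0 < I a b f.
Proof.
move=> ab bf cf f0.
have [|K K0 HK] := int_tent_small bf cf (_ : 0 < (b - a) / 2); first lra.
have bKf : bmeas a b (fun t => 1 - K * f t).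
  by apply: bmeasB; [exact: bmeas_cst|exact: bmeasZ].
have H : I a b (fun t => 1 - K * f t) <=
    I a b (fun t => Num.max 0 (1 - K * `|f t|)).
  apply: int_le => //.
    apply: bmeas_max; first exact: bmeas_cst.
    by apply: bmeasB; [exact: bmeas_cst|apply: bmeasZ; exact: bmeas_norm].
  by move=> t tab; rewrite ger0_norm ?f0// le_max lexx orbT.
have E : I a b (fun t => 1 - K * f t) = b - a - K * I a b f.
  rewrite intB; [|exact: bmeas_cst|exact: bmeasZ].
  by rewrite intZ// int_cst ?mul1r// ltW.
rewrite E in H.
have : 0 < K * I a b f by lra.
have I0 : 0 <= I a b f by exact: int_ge0.
rewrite !lt_def I0 andbT => /andP[+ _]; apply: contraNneq => ->.
by rewrite mulr0.
Qed.

End IntegralZeros.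

(** * Vector integrals, tested against fixed directions *)

Section VectorIntegral.
Variable R : realType.
Local Notation mu := (@lebesgue_measure R).
Local Notation I a b f := (Rintegral mu `[a, b] f).

Definition vbmeas n (a b : R) (F : R -> 'cV[R]_n) :=
  forall j, bmeas a b (fun t => F t j 0).

Lemma bmeas_dotv n a b (z : 'cV[R]_n) F : vbmeas a b F ->
  bmeas a b (fun t => dotv z (F t)).
Proof. by move=> bF; apply: bmeas_sum => j; apply: bmeasZ; exact: bF. Qed.

Lemma dotv_vint n a b (z : 'cV[R]_n) F : vbmeas a b F ->
  dotv z (vint a b F) = I a b (fun t => dotv z (F t)).
Proof.
move=> bF; rewrite int_sum => [|j]; last by apply: bmeasZ; exact: bF.
by apply: eq_bigr => j _; rewrite mxE intZ//; exact: bF.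
Qed.

Lemma coord_dotv n (x : 'cV[R]_n) i : x i 0 = dotv (delta_mx i 0) x.
Proof.
rewrite /dotv (bigD1 i)//= mxE !eqxx mul1r big1 ?addr0// => j ji.
by rewrite mxE (negbTE ji) mul0r.
Qed.

Lemma vbmeas_dotvP n a b (F : R -> 'cV[R]_n) :
  (forall z, bmeas a b (fun t => dotv z (F t))) -> vbmeas a b F.
Proof.
move=> bF j; apply: bmeas_eq (bF (delta_mx j 0)) => t _.
by rewrite -coord_dotv.
Qed.

Lemma dotv_inj n (x y : 'cV[R]_n) : (forall z, dotv z x = dotv z y) -> x = y.
Proof. by move=> H; apply/colP => i; rewrite !coord_dotv. Qed.

Lemma vbmeas_mulmx n m a b (C : 'M[R]_(m, n)) F : vbmeas a b F ->
  vbmeas a b (fun t => C *m F t).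
Proof.
move=> bF; apply: vbmeas_dotvP => z.
by apply: bmeas_eq (bmeas_dotv (C^T *m z) bF) => t _; rewrite dotv_mulmx.
Qed.

Lemma mulmx_vint n m a b (C : 'M[R]_(m, n)) F : vbmeas a b F ->
  C *m vint a b F = vint a b (fun t => C *m F t).
Proof.
move=> bF; apply: dotv_inj => z; rewrite dotv_mulmx !dotv_vint//; last first.
  exact: vbmeas_mulmx.
by apply: int_eq => t _; rewrite dotv_mulmx.
Qed.

Lemma vint_eq n a b (F G : R -> 'cV[R]_n) :
  (forall t, a <= t <= b -> F t = G t) -> vint a b F = vint a b G.
Proof. by move=> FG; apply/colP => j; rewrite !mxE; apply: int_eq => t /FG ->. Qed.

End VectorIntegral.

(** * Reachable sets and their support function *)

Section Reach.
Variables (R : realType) (N M : nat) (A : 'M[R]_N) (B : 'M[R]_(N, M)).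
Local Notation mu := (@lebesgue_measure R).
Local Notation I a b f := (Rintegral mu `[a, b] f).
Implicit Types (x y z : 'cV[R]_N) (u v : R -> 'cV[R]_M).

Definition bang j s : 'cV[R]_N := expm A (- s) *m col j B.

(** The switching function of the [j]-th input in direction [z]: the extremal control takes minus
    its sign, and its zeros are the possible switching times. *)
Definition gain z j s : R := dotv z (bang j s).

Definition ctrl u s : 'cV[R]_N := expm A (- s) *m (B *m u s).

Definition reach (theta : R) x :=
  exists u, admissible theta u /\ x = - vint 0 theta (ctrl u).

Definition supp z (theta : R) : R := \sum_j I 0 theta (fun s => `|gain z j s|).

Definition extremal z (theta : R) : 'cV[R]_N :=
  - vint 0 theta (ctrl (fun s => \col_j - Num.sg (gain z j s))).

Lemma continuous_gain z j : continuous (gain z j).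
Proof.
move=> s; rewrite /gain /bang.
apply: (@continuous_comp _ _ _ -%R (fun t => dotv z (expm A t *m col j B))).
  exact: opp_continuous.
exact: continuous_dotv_expm.
Qed.

Lemma countable_gain z j : \rank (kalman A (col j B)) = N -> z != 0 ->
  countable [set s | gain z j s = 0].
Proof.
move=> rk z0; have := countable_zeros_dotv_expm rk z0; set S := [set t | _] => cS.
apply: (@sub_countable _ _ _ (-%R @` S)); last first.
  exact: sub_countable (card_image_le _ _) cS.
by apply: subset_card_le => s gs; exists (- s) => //; rewrite opprK.
Qed.

Lemma vbmeas_bang a b j : vbmeas a b (bang j).
Proof.
apply: vbmeas_dotvP => z; apply: bmeas_continuous; exact: continuous_gain.
Qed.

Lemma bmeas_gain a b z j : bmeas a b (gain z j).
Proof. exact/bmeas_continuous/continuous_gain. Qed.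

Lemma bmeas_normgain a b z j : bmeas a b (fun s => `|gain z j s|).
Proof. exact/bmeas_norm/bmeas_gain. Qed.

Lemma mulmx_cols (w : 'cV[R]_M) : B *m w = \sum_j w j 0 *: col j B.
Proof.
apply/colP => i; rewrite !mxE summxE; apply: eq_bigr => j _.
by rewrite !mxE mulrC.
Qed.

Lemma dotv_ctrl z u s : dotv z (ctrl u s) = \sum_j u s j 0 * gain z j s.
Proof.
rewrite /ctrl mulmx_cols mulmx_sumr dotv_sumr; apply: eq_bigr => j _.
by rewrite -scalemxAr dotvZr.
Qed.

Lemma admissible_vbmeas theta u : admissible theta u -> vbmeas 0 theta u.
Proof.
move=> [mu1 ub] j; split; first exact: mu1.
by exists 1 => t /ub /(_ j); rewrite ler_norml.
Qed.

Lemma vbmeas_ctrl a b u : vbmeas a b u -> vbmeas a b (ctrl u).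
Proof.
move=> bu; apply: vbmeas_dotvP => z.
have : bmeas a b (fun s => \sum_j u s j 0 * gain z j s).
  by apply: bmeas_sum => j; apply: bmeasM; [exact: bu|exact: bmeas_gain].
by apply: bmeas_eq => s _; rewrite dotv_ctrl.
Qed.

Lemma fwd_solE theta u x : admissible theta u ->
  fwd_sol A B u x theta = expm A theta *m (x + vint 0 theta (ctrl u)).
Proof.
move=> /admissible_vbmeas bu; rewrite /fwd_sol mulmxDr; congr (_ + _).
rewrite mulmx_vint; last exact: vbmeas_ctrl.
by apply: vint_eq => s _; rewrite /ctrl [RHS]mulmxA -expmD.
Qed.

Lemma steerP theta x :
  (exists u, admissible theta u /\ fwd_sol A B u x theta = 0) <-> reach theta x.
Proof.
split=> -[u [au H]]; exists u; split => //.
  rewrite fwd_solE// in H; apply/eqP; rewrite -addr_eq0.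
  move/(congr1 (mulmx (expm A (- theta)))): H.
  by rewrite mulmxA expmKN mul1mx mulmx0 => ->.
by rewrite fwd_solE// H addNr mulmx0.
Qed.

(** Concatenation: a control for [x] is followed up to [theta], then [v], whose part of the integral
    is the displacement of the starting point. *)
Lemma reach_cat theta theta' x v : 0 <= theta -> theta <= theta' ->
  reach theta x -> vbmeas theta theta' v ->
  (forall t, theta <= t <= theta' -> forall j, -1 <= v t j 0 <= 1) ->
  reach theta' (x - vint theta theta' (ctrl v)).
Proof.
move=> t0 tt' [u [au ->]] bv v1.
pose w t := if t <= theta then u t else v t.
have aw : admissible theta' w.
  split=> [j|t /andP[t0' t1] j].
    rewrite (_ : (fun t => _) = (fun t => if t <= theta then u t j 0 else v t j 0));
      last by apply/funext => t; rewrite /w; case: ifP.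
    apply: measurable_fun_if => //.
    - exact: measurable_fun_ler.
    - apply: (@measurable_funS _ _ _ _ `[0, theta]); last exact: au.1.
        exact: measurable_itv.
      by move=> t /= []; rewrite !in_itv/= => /andP[-> _] ->.
    - apply: (@measurable_funS _ _ _ _ `[theta, theta']); last exact: (bv j).1.
        exact: measurable_itv.
      move=> t /= []; rewrite !in_itv/= => /andP[_ ->]; rewrite andbT.
      by move/negbT; rewrite -ltNge => /ltW.
  rewrite /w; case: (leP t theta) => tt; first by apply: au.2; rewrite t0'.
  by apply: v1; rewrite (ltW tt).
exists w; split=> //; apply: dotv_inj => z; rewrite -opprD !dotvNr; congr (- _).
have bw := vbmeas_ctrl (admissible_vbmeas aw).
have bu := vbmeas_ctrl (admissible_vbmeas au).
rewrite dotvDr !dotv_vint//; last exact: vbmeas_ctrl.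
rewrite [RHS](int_chasles t0 tt'); last exact: bmeas_dotv.
congr (_ + _).
  by apply: int_eq => t /andP[_ tt]; rewrite /ctrl /w tt.
apply: int_ae_eq.
- by apply: bmeas_dotv; exact: vbmeas_ctrl.
- by apply: bmeasS (bmeas_dotv z bw).
(* The concatenated control still follows [u] at the junction [theta], so it agrees with [v] only
   off this point. *)
- have := countable_ae (countable1 theta).
  move=> [S [mS S0 sub]]; exists S; split=> // t Ht; apply: sub => /= tn.
  apply: Ht => /andP[tt _]; rewrite /ctrl /w leNgt lt_neqAle tt andbT.
  by rewrite eq_sym; case: eqP.
Qed.

Lemma reach_mono theta theta' x : 0 <= theta -> theta <= theta' ->
  reach theta x -> reach theta' x.
Proof.
move=> t0 tt' rx.
have := @reach_cat theta theta' x (fun=> 0) t0 tt' rx.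
have -> : vint theta theta' (ctrl (fun=> 0)) = 0.
  apply: dotv_inj => z; rewrite dotv_vint; last first.
    by apply: vbmeas_ctrl => j; exact: bmeas_cst.
  rewrite dotv0r (int_eq (g := fun=> 0)); first by rewrite int_cst// mul0r.
  by move=> t _; rewrite /ctrl !mulmx0 dotv0r.
rewrite subr0; apply.
  by move=> j; exact: bmeas_cst.
by move=> t _ j; rewrite mxE; lra.
Qed.

Lemma vbmeas_norm_le n a b (F : R -> 'cV[R]_n) : vbmeas a b F ->
  exists2 C, 0 <= C & forall t, a <= t <= b -> `|F t| <= C.
Proof.
move=> bF; have /choice[C HC] : forall j, exists C : R,
    forall t, a <= t <= b -> `|F t j 0| <= C by move=> j; exact: (bF j).2.
exists (\sum_j `|C j|); first exact: sumr_ge0.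
move=> t tab; apply: mx_norm_le => [|i j]; first exact: sumr_ge0.
rewrite ord1 (bigD1 i)//= (le_trans (HC _ _ tab))// (le_trans (ler_norm _))//.
by rewrite lerDl sumr_ge0.
Qed.

Lemma gain_le (theta : R) : exists2 C, 0 <= C &
  forall z j s, 0 <= s <= theta -> `|gain z j s| <= C * `|z|.
Proof.
have /choice[C HC] : forall j, exists C : R,
    0 <= C /\ forall t, 0 <= t <= theta -> `|bang j t| <= C.
  by move=> j; have [C] := vbmeas_norm_le (@vbmeas_bang 0 theta j); exists C.
exists (N%:R * \sum_j C j); first by rewrite mulr_ge0// sumr_ge0// => j _; case: (HC j).
move=> z j s sab; rewrite (le_trans (dotv_norm_le _ _))// mulrAC ler_wpM2r//.
rewrite ler_wpM2l// (le_trans ((HC j).2 _ sab))// (bigD1 j)//= lerDl.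
by apply: sumr_ge0 => k _; case: (HC k).
Qed.

Lemma reach_dotv_le theta x z : reach theta x -> dotv z x <= supp z theta.
Proof.
move=> [u [au ->]]; have bu := vbmeas_ctrl (admissible_vbmeas au).
rewrite dotvNr dotv_vint// -intN; last exact: bmeas_dotv.
rewrite /supp -int_sum; last by move=> j; exact: bmeas_normgain.
apply: int_le.
- by apply: bmeasN; exact: bmeas_dotv.
- by apply: bmeas_sum => j; exact: bmeas_normgain.
move=> t tab; rewrite dotv_ctrl -sumrN; apply: ler_sum => j _.
rewrite (le_trans (ler_norm _))// normrN normrM ler_piMl//.
by rewrite ler_norml; exact: au.2.
Qed.

Lemma admissible_sg theta z :
  admissible theta (fun s => \col_j - Num.sg (gain z j s)).
Proof.
split=> [j|t _ j]; last first.
  by rewrite mxE -ler_norml normrN normr_sg lern1 leq_b1.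
rewrite (_ : (fun t => _) = (fun t => - Num.sg (gain z j t))); last first.
  by apply/funext => t; rewrite mxE.
by apply: (bmeasN _).1; apply: bmeas_sg; exact: (bmeas_gain _ _ _ _).1.
Qed.

Lemma reach_extremal theta z : reach theta (extremal z theta).
Proof. by eexists; split; first exact: admissible_sg. Qed.

Lemma dotv_extremal theta z : dotv z (extremal z theta) = supp z theta.
Proof.
have bu := vbmeas_ctrl (admissible_vbmeas (admissible_sg theta z)).
rewrite dotvNr dotv_vint// -intN; last exact: bmeas_dotv.
rewrite /supp -int_sum; last by move=> j; exact: bmeas_normgain.
apply: int_eq => t _; rewrite dotv_ctrl -sumrN; apply: eq_bigr => j _.
by rewrite mxE mulNr opprK normrEsg.
Qed.

Lemma suppB z theta theta' : 0 <= theta -> theta <= theta' ->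
  supp z theta' - supp z theta = \sum_j I theta theta' (fun s => `|gain z j s|).
Proof.
move=> t0 tt'; rewrite /supp -sumrB; apply: eq_bigr => j _.
by rewrite (int_chasles t0 tt' (bmeas_normgain _ _ _ _)) addrC addKr.
Qed.

Lemma supp_mono z theta theta' : 0 <= theta -> theta <= theta' ->
  supp z theta <= supp z theta'.
Proof.
move=> t0 tt'; rewrite -subr_ge0 suppB//.
by apply: sumr_ge0 => j _; exact: int_ge0.
Qed.

Lemma supp_lipschitz (theta0 : R) : exists2 C, 0 <= C &
  forall z theta theta', 0 <= theta -> theta <= theta' -> theta' <= theta0 ->
  supp z theta' - supp z theta <= C * `|z| * (theta' - theta).
Proof.
have [C C0 HC] := gain_le theta0; exists (M%:R * C); first by rewrite mulr_ge0.
move=> z t t' t0 tt' t'0; rewrite suppB//.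
apply: (@le_trans _ _ (\sum_(j < M) C * `|z| * (t' - t))); last first.
  by rewrite sumr_const card_ord -[leLHS]mulr_natl !mulrA.
apply: ler_sum => j _; rewrite -int_cst//; apply: int_le.
- exact: bmeas_normgain.
- exact: bmeas_cst.
- by move=> s /andP[ts st']; apply: HC; rewrite (le_trans t0)//= (le_trans st').
Qed.

Lemma supp_lipschitz_l (theta : R) : 0 <= theta -> exists2 C, 0 <= C &
  forall z z', supp z theta - supp z' theta <= C * `|z - z'|.
Proof.
move=> t0; have [C C0 HC] := gain_le theta.
exists (M%:R * C * theta); first by rewrite !mulr_ge0.
move=> z z'; rewrite -sumrB.
apply: (@le_trans _ _ (\sum_(j < M) C * `|z - z'| * theta)); last first.
  by rewrite sumr_const card_ord -[leLHS]mulr_natl; lra.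
apply: ler_sum => j _.
rewrite -intB; [|exact: bmeas_normgain|exact: bmeas_normgain].
rewrite -[X in _ * X]subr0 -int_cst//; apply: int_le.
- by apply: bmeasB; exact: bmeas_normgain.
- exact: bmeas_cst.
- move=> s st; rewrite (le_trans (lerB_dist _ _))// -dotvBl; exact: HC.
Qed.

End Reach.

(** * Limit arguments by real inequalities *)

Section RealLimits.
Variable R : realType.

(** Stands in for letting [h] tend to 0. Only [h] in []0, 1]] is tested, so constants valid on a
    bounded time interval suffice. *)
Lemma le_affine_limit (L P Q : R) : 0 <= P ->
  (forall h, 0 < h <= 1 -> L <= P * h + Q) -> L <= Q.
Proof.
move=> P0 H; rewrite leNgt; apply/negP => QL.
have d0 : 0 < P + 1 + (L - Q) by lra.
(* If [Q < L], this value of [h] is at most 1 and satisfies [P * h < L - Q], against the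
   hypothesis. *)
have h0 : 0 < (L - Q) / (P + 1 + (L - Q)) by rewrite divr_gt0//; lra.
have h1 : (L - Q) / (P + 1 + (L - Q)) <= 1 by rewrite ler_pdivrMr// mul1r; lra.
have := H _ (introT andP (conj h0 h1)); rewrite -lerBlDr mulrA ler_pdivlMr//.
by nra.
Qed.

(* Multiply [1 - K * `|g|] by [`|w|] where it is nonnegative. *)
Lemma int_weight_le (a b K : R) (g w : R -> R) :
  bmeas a b g -> bmeas a b w -> 0 <= K ->
  (forall t, a <= t <= b -> `|w t| <= 2) ->
  Rintegral lebesgue_measure `[a, b] (fun t => `|w t|) <=
  K * Rintegral lebesgue_measure `[a, b] (fun t => `|g t| * `|w t|) +
  2 * Rintegral lebesgue_measure `[a, b] (fun t => Num.max 0 (1 - K * `|g t|)).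
Proof.
move=> bg bw K0 w2.
have b1 : bmeas a b (fun t => `|g t| * `|w t|).
  by apply: bmeasM; exact: bmeas_norm.
have b2 : bmeas a b (fun t => Num.max 0 (1 - K * `|g t|)).
  apply: bmeas_max; first exact: bmeas_cst.
  by apply: bmeasB; [exact: bmeas_cst|apply: bmeasZ; exact: bmeas_norm].
rewrite -intZ// -intZ// -intD; [|exact: bmeasZ|exact: bmeasZ].
apply: int_le; [exact: bmeas_norm|by apply: bmeasD; exact: bmeasZ|].
move=> t /w2; have := normr_ge0 (w t); have := normr_ge0 (g t).
set G := `|g t|; set W := `|w t| => G0 W0 W2.
by case: (leP 0 (1 - K * G)) => h; nra.
Qed.

End RealLimits.

(** * Separation of a point from a bounded convex set *)

Section Separation.
Variables (R : realType) (n : nat).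

(* An almost-nearest point [p] of [C] already yields a separating direction. *)
Lemma convex_separation (C : set 'cV[R]_n) (y : 'cV[R]_n) (D d : R) :
  (forall p q s, C p -> C q -> 0 <= s <= 1 -> C ((1 - s) *: p + s *: q)) ->
  C !=set0 -> (forall p, C p -> `|p| <= D) ->
  0 < d -> (forall p, C p -> d <= `|y - p|) ->
  exists2 v : 'cV[R]_n, v != 0 & forall p, C p -> dotv v p <= dotv v y.
Proof.
move=> convC [c0 Cc0] CD d0 Cd.
pose Q (p : 'cV[R]_n) := dotv (y - p) (y - p).
pose S := [set Q p | p in C].
have SQ p : C p -> d ^+ 2 <= Q p.
  move=> /Cd dp; apply: le_trans (norm_sqr_le_dotv _).
  by rewrite lerXn2r// nnegrE ?normr_ge0 ?ltW.
have hS : has_inf S.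
  by split; [exists (Q c0), c0|exists (d ^+ 2) => _ [p Cp <-]; exact: SQ].
set m := inf S; have m0 : 0 < m.
  apply: (@lt_le_trans _ _ (d ^+ 2)); first by rewrite exprn_gt0.
  by apply: lb_le_inf hS.1 _ => _ [p Cp <-]; exact: SQ.
(* A bound for the squared Euclidean distance between any two points of [C]. *)
pose E := n%:R * (D + D) ^+ 2.
have E0 : 0 <= E by rewrite mulr_ge0// sqr_ge0.
(* Chosen so that [s * (1 + E) <= m]. If [p] minimizes [Q] up to [s ^+ 2], comparing it with its
   mixture with [z] of weight [s] gives [2 * <y - p, z - p> <= s * (1 + E) <= m <= Q p], which is
   more than the separation inequality. *)
pose s := m / (1 + E + m).
have den : 0 < 1 + E + m by lra.
have s0 : 0 < s by rewrite divr_gt0.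
have s1 : s <= 1 by rewrite ler_pdivrMr// mul1r; lra.
have sE : s * (1 + E) <= m.
  by rewrite /s mulrAC ler_pdivrMr//; nra.
have [_ [p Cp <-] Qp] := inf_adherent (exprn_gt0 2 s0) hS.
rewrite -/m in Qp.
have mQ q : C q -> m <= Q q.
  by move=> Cq; apply: ge_inf; [exact: hS.2|exists q].
exists (y - p).
  by rewrite -dotv_eq0 gt_eqF// (lt_le_trans m0)// mQ.
move=> z Cz.
have zpE : dotv (z - p) (z - p) <= E.
  rewrite (le_trans (ler_norm _))// (le_trans (dotv_norm_le _ _))// /E -mulrA.
  rewrite ler_wpM2l// expr2.
  have H : `|z - p| <= D + D by rewrite (le_trans (ler_normB _ _))// lerD// CD.
  by rewrite ler_pM.
have s01 : 0 <= s <= 1 by rewrite (ltW s0).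
have := mQ _ (convC _ _ _ Cp Cz s01).
have -> : Q ((1 - s) *: p + s *: z) =
    Q p - 2 * s * dotv (y - p) (z - p) + s ^+ 2 * dotv (z - p) (z - p).
  rewrite /Q; have -> : y - ((1 - s) *: p + s *: z) = (y - p) - s *: (z - p).
    by apply/colP => i; rewrite !mxE; ring.
  move: (y - p) (z - p) => a b.
  by rewrite dotvBl !dotvBr !dotvZl !dotvZr (dotvC b a); ring.
move=> H; have vp : dotv (y - p) y = Q p + dotv (y - p) p.
  by rewrite /Q dotvBr subrK.
rewrite vp -lerBlDr -dotvBr.
have := mQ _ Cp; rewrite expr2 in Qp; rewrite expr2 in H; nra.
Qed.

End Separation.

(** * Size, convexity, thickness and extremal points of reachable sets *)

Section ReachGeometry.
Variables (R : realType) (N M : nat) (A : 'M[R]_N) (B : 'M[R]_(N, M)).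
Local Notation mu := (@lebesgue_measure R).
Local Notation I a b f := (Rintegral mu `[a, b] f).
Implicit Types (x y z : 'cV[R]_N).
Local Notation reach := (reach A B).
Local Notation gain := (gain A B).
Local Notation bang := (bang A B).
Local Notation ctrl := (ctrl A B).
Local Notation supp := (supp A B).
Local Notation extremal := (extremal A B).

Lemma reach_convex theta p q s : reach theta p -> reach theta q ->
  0 <= s <= 1 -> reach theta ((1 - s) *: p + s *: q).
Proof.
move=> [u [au ->]] [v [av ->]] s01.
have bu := admissible_vbmeas au; have bv := admissible_vbmeas av.
pose w t := (1 - s) *: u t + s *: v t.
have bw : vbmeas 0 theta w.
  move=> j; have : bmeas 0 theta (fun t => (1 - s) * u t j 0 + s * v t j 0).
    by apply: bmeasD; apply: bmeasZ.
  by apply: bmeas_eq => t _; rewrite !mxE.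
exists w; split.
  split=> [j|t tt j]; first exact: (bw j).1.
  have := au.2 t tt j; have := av.2 t tt j; rewrite !mxE; nra.
have cu := vbmeas_ctrl A B bu; have cv := vbmeas_ctrl A B bv.
apply: dotv_inj => z; rewrite dotvDr !dotvZr !dotvNr.
rewrite (dotv_vint z cu) (dotv_vint z cv) (dotv_vint z (vbmeas_ctrl A B bw)).
rewrite !mulrN -opprD; congr (- _).
have du := bmeas_dotv z cu; have dv := bmeas_dotv z cv.
rewrite -(intZ _ du) -(intZ _ dv) -(intD (bmeasZ _ du) (bmeasZ _ dv)).
apply: int_eq => t _; rewrite /ctrl /w !mulmxDr -!scalemxAr.
by rewrite dotvDr !dotvZr.
Qed.

(** The support function vanishes at time 0 and is Lipschitz in time; it is tested in the directions
    of plus and minus each basis vector. *)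
Lemma reach_norm_le (theta0 : R) : exists2 C, 0 <= C &
  forall theta x, 0 <= theta <= theta0 -> reach theta x -> `|x| <= C * theta.
Proof.
have [C C0 HC] := supp_lipschitz A B theta0; exists C => // theta x /andP[t0 t1] rx.
have supp0 z : supp z 0 = 0.
  rewrite /supp big1// => j _; apply/eqP; rewrite -normr_le0.
  have [K K0 HK] := gain_le A B 0.
  rewrite (le_trans (@int_norm_le_cst _ 0 0 (K * `|z|) _ (lexx _) _ _))//.
  - exact: bmeas_normgain.
  - by move=> t tt; rewrite normr_id HK.
  - by rewrite subrr mulr0.
have H z : `|z| <= 1 -> dotv z x <= C * theta.
  move=> z1; apply: le_trans (reach_dotv_le z rx) _.
  have := HC z 0 theta (lexx _) t0 t1; rewrite supp0 !subr0 => /le_trans; apply.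
  by rewrite ler_wpM2r// ler_piMr.
apply: mx_norm_le => [|i j]; first by rewrite mulr_ge0.
have e1 : `|delta_mx i 0 : 'cV[R]_N| <= 1.
  apply: mx_norm_le => // a b; rewrite mxE; case: (_ && _); by rewrite ?normr1 ?normr0.
rewrite ord1 coord_dotv ler_norml lerNl -dotvNl !H// normrN//.
Qed.

(** This is the controllability Gramian of the single input [b_j]. Its quadratic form at [z] is the
    integral of the square of [gain z j], positive for [z != 0] because [gain z j] has countably
    many zeros. *)
Lemma gramian_unit (a b : R) j : \rank (kalman A (col j B)) = N -> a < b ->
  (\matrix_(i, k) I a b (fun s => bang j s i 0 * bang j s k 0)) \in unitmx.
Proof.
move=> rk ab; set W := \matrix_(i, k) _.
rewrite -row_free_unit; apply: inj_row_free => v vW.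
apply/eqP/negPn/negP => v0.
pose z := v^T; have z0 : z != 0.
  by apply: contraNneq v0 => z0; rewrite -[v]trmxK -/z z0 trmx0.
have : 0 < I a b (fun s => gain z j s * gain z j s).
  apply: int_gt0 => //; first by apply: bmeasM; exact: bmeas_gain.
    apply: sub_countable (countable_gain rk z0); apply: subset_card_le => s /=.
    by move/eqP; rewrite mulf_eq0 orbb => /eqP.
  by move=> t _; rewrite -expr2 sqr_ge0.
suff -> : I a b (fun s => gain z j s * gain z j s) = (v *m W *m z) 0 0.
  by rewrite vW mul0mx mxE ltxx.
have bb := vbmeas_bang A B a b j.
rewrite (int_eq (g := fun s => \sum_k \sum_i
    (v 0 i * z k 0) * (bang j s i 0 * bang j s k 0))); last first.
  move=> t _; rewrite /gain /dotv mulr_sumr; apply: eq_bigr => k _.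
  by rewrite mulr_suml; apply: eq_bigr => i _; rewrite /z !mxE; ring.
rewrite int_sum => [|k]; last first.
  by apply: bmeas_sum => i; apply: bmeasZ; apply: bmeasM.
rewrite mxE; apply: eq_bigr => k _; rewrite int_sum => [|i]; last first.
  by apply: bmeasZ; apply: bmeasM.
rewrite [(v *m W) _ _]mxE mulr_suml; apply: eq_bigr => i _.
by rewrite intZ ?[W _ _]mxE; [ring|exact: bmeasM].
Qed.

(** During the extra time [e] only input [j] acts, with control [gain y j]. Its effect is the
    Gramian [W] applied to [y], so [y = - W^{-1} h] produces exactly the displacement [h], and the
    control is admissible when [h] is small. *)
Lemma reach_perturb theta e j : \rank (kalman A (col j B)) = N ->
  0 <= theta -> 0 < e -> exists2 d, 0 < d &
  forall x h, reach theta x -> `|h| < d -> reach (theta + e) (x + h).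
Proof.
move=> rk t0 e0; have te : theta < theta + e by rewrite ltrDl.
have := gramian_unit rk te; set W := \matrix_(i, k) _ => uW.
have bV : vbmeas theta (theta + e) (fun s => (invmx W)^T *m bang j s).
  by apply: vbmeas_mulmx; exact: vbmeas_bang.
have [C C0 HC] := vbmeas_norm_le bV.
have NC : 0 < N%:R * C + 1 by rewrite ltr_wpDl// mulr_ge0.
(* With [C] bounding [W^{-T} e^{-As} b_j], the control has modulus at most [N * |h| * C], which this
   radius keeps below 1. *)
exists (N%:R * C + 1)^-1; first by rewrite invr_gt0.
move=> x h rx hd; pose y := - (invmx W *m h).
pose v s : 'cV[R]_M := gain y j s *: delta_mx j 0.
have vE s k : v s k 0 = gain y j s * (k == j)%:R by rewrite !mxE eqxx andbT.
have bv : vbmeas theta (theta + e) v.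
  move=> k; have : bmeas theta (theta + e) (fun s => gain y j s * (k == j)%:R).
    by apply: bmeasM; [exact: bmeas_gain|exact: bmeas_cst].
  by apply: bmeas_eq => s _; rewrite vE.
have bb := vbmeas_bang A B theta (theta + e) j.
have -> : x + h = x - vint theta (theta + e) (ctrl v).
  congr (_ + _).
  have -> : h = - (W *m y) by rewrite /y mulmxN opprK mulmxA mulmxV// mul1mx.
  congr (- _); apply/colP => i; rewrite !mxE.
  rewrite (int_eq (g := fun s => \sum_k y k 0 * (bang j s i 0 * bang j s k 0))).
    rewrite int_sum => [|k]; last by apply: bmeasZ; apply: bmeasM.
    apply: eq_bigr => k _; rewrite intZ; last by apply: bmeasM.
    by rewrite mxE mulrC.
  move=> s _; rewrite coord_dotv dotv_ctrl (bigD1 j)//= big1 => [|k kj]; last first.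
    by rewrite vE (negbTE kj) mulr0 mul0r.
  rewrite vE eqxx mulr1 addr0 {2}/gain -coord_dotv /gain /dotv mulr_suml.
  by apply: eq_bigr => k _; ring.
apply: reach_cat => //; first exact: ltW.
move=> s st k; rewrite -ler_norml vE normrM.
have g1 : `|gain y j s| <= 1.
  rewrite /gain /y dotvNl normrN dotvC dotv_mulmx dotvC.
  rewrite (le_trans (dotv_norm_le _ _))//.
  apply: (@le_trans _ _ (N%:R * (N%:R * C + 1)^-1 * C)).
    by rewrite ler_pM// ?mulr_ge0// ?ler_wpM2l// ?HC// ltW.
  by rewrite mulrAC ler_pdivrMr// mul1r lerDl.
by case: (k == j); rewrite ?normr1 ?mulr1 ?normr0 ?mulr0.
Qed.

(* Near-optimality of [u] in the direction [z] forces [u] to be close in L1 to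
   the bang-bang control, because [gain z j] vanishes only on a null set. *)
Lemma reach_unique r x z : (forall j, \rank (kalman A (col j B)) = N) ->
  0 <= r -> z != 0 -> (forall theta, r < theta -> reach theta x) ->
  supp z r <= dotv z x -> x = extremal z r.
Proof.
move=> rk r0 z0 rx sz; apply: dotv_inj => y; apply/eqP; rewrite -subr_eq0 -normr_le0.
have [C C0 HC] := gain_le A B (r + 1).
set L := `|_|.
have MC0 : 0 <= M%:R * C by rewrite mulr_ge0.
(* Two limits in order: the extra time [h] goes to 0 with [e], and hence the constants [K j], fixed;
   then [e] goes to 0. *)
apply: (@le_affine_limit _ _ (2 * (M%:R * C * `|y|))); first by rewrite !mulr_ge0.
move=> e /andP[e0 _]; rewrite addr0.
have /choice[K HK] : forall j, exists K, 0 <= K /\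
    I 0 r (fun t => Num.max 0 (1 - K * `|gain z j t|)) < e.
  move=> j; have [K K0 KI] := @int_tent_small _ 0 r e _ (bmeas_gain A B 0 r z j)
    (countable_gain (rk j) z0) e0.
  by exists K.
have SK0 : 0 <= \sum_j K j by apply: sumr_ge0 => j _; case: (HK j).
pose P := C * `|y| * ((\sum_j K j) * (M%:R * C * `|z|)) + M%:R * C * `|y|.
apply: (@le_affine_limit _ _ P); first by rewrite addr_ge0 ?mulr_ge0.
move=> h /andP[h0 h1].
have rh : r < r + h by rewrite ltrDl.
have [u [au xE]] := rx _ rh.
have bu := admissible_vbmeas au; have cu := vbmeas_ctrl A B bu.
have bur : vbmeas 0 r u by move=> j; apply: bmeasS (bu j) => //; exact: ltW.
have dotx t : dotv t x = - I 0 r (fun s => dotv t (ctrl u s))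
    - I r (r + h) (fun s => dotv t (ctrl u s)).
  rewrite xE dotvNr (dotv_vint t cu) -opprD; congr (- _).
  by apply: int_chasles => //; [exact: ltW|exact: bmeas_dotv].
have tail t : `|I r (r + h) (fun s => dotv t (ctrl u s))| <= M%:R * C * `|t| * h.
  have -> : M%:R * C * `|t| * h = M%:R * C * `|t| * (r + h - r) by lra.
  apply: int_norm_le_cst; first exact: ltW.
    by apply: bmeasS (bmeas_dotv t cu).
  move=> s /andP[rs sr]; rewrite dotv_ctrl (le_trans (ler_norm_sum _ _ _))//.
  apply: (@le_trans _ _ (\sum_(j < M) C * `|t|)); last first.
    by rewrite sumr_const card_ord -[leLHS]mulr_natl mulrA.
  apply: ler_sum => j _; rewrite normrM -[leRHS]mul1r ler_pM//.
    by rewrite ler_norml; apply: au.2; rewrite (le_trans r0).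
  by apply: HC; rewrite (le_trans r0)//= (le_trans sr)// lerD2l.
(* The deviation of [u] from the extremal control, which is minus the sign of [gain z j]. *)
pose w j s := u s j 0 + Num.sg (gain z j s).
have bw j : bmeas 0 r (w j).
  by apply: bmeasD => //; apply: bmeas_sg; exact: (bmeas_gain A B 0 r z j).1.
have u1 j s : 0 <= s <= r -> -1 <= u s j 0 <= 1.
  by move=> /andP[s0 sr]; apply: au.2; rewrite s0 (le_trans sr)// ltW.
have w2 j s : 0 <= s <= r -> `|w j s| <= 2.
  move=> /(u1 j) us; rewrite ler_norml /w.
  by case: (sgrP (gain z j s)) => _; lra.
have gw j s : 0 <= s <= r ->
    `|gain z j s| * `|w j s| = `|gain z j s| + u s j 0 * gain z j s.
  move=> /(u1 j) us; rewrite -normrM /w.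
  case: (sgrP (gain z j s)) => [->|g0|g0].
  - by rewrite mul0r mulr0 normr0 ?addr0.
  - by rewrite ger0_norm; [ring|nra].
  - by rewrite ger0_norm; [ring|nra].
have bgw j : bmeas 0 r (fun s => `|gain z j s| * `|w j s|).
  by apply: bmeasM; apply: bmeas_norm => //; exact: bmeas_gain.
have bug t j : bmeas 0 r (fun s => u s j 0 * gain t j s).
  by apply: bmeasM => //; exact: bmeas_gain.
(* The weighted deviation is what [u] loses against [supp z r] on [[0, r]]. As [<z, x>] is at least
   [supp z r], the loss must be regained on [[r, r + h]], so it is [O(h)]. *)
have Sgw : \sum_j I 0 r (fun s => `|gain z j s| * `|w j s|) <=
    M%:R * C * `|z| * h.
  apply: le_trans (tail z); rewrite -normrN; apply: le_trans (ler_norm _).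
  have -> : - I r (r + h) (fun s => dotv z (ctrl u s)) =
      dotv z x + I 0 r (fun s => dotv z (ctrl u s)) by rewrite dotx; ring.
  apply: le_trans (_ : supp z r + I 0 r (fun s => dotv z (ctrl u s)) <= _);
    last by rewrite lerD2r.
  rewrite (int_eq (f := fun s => dotv z (ctrl u s))
    (g := fun s => \sum_j u s j 0 * gain z j s)); last first.
    by move=> s _; rewrite dotv_ctrl.
  rewrite (int_sum (bug z)) -big_split/=; apply: ler_sum => j _.
  rewrite -(intD (bmeas_normgain _ _ _ _ _ _) (bug z j)) le_eqVlt.
  by apply/orP; left; apply/eqP/int_eq => s /gw.
have Iw j : I 0 r (fun s => `|w j s|) <= K j * (M%:R * C * `|z| * h) + 2 * e.
  have [K0 Ke] := HK j.
  apply: le_trans (int_weight_le (bmeas_gain A B 0 r z j) (bw j) K0 (w2 j)) _.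
  apply: lerD; last by rewrite ler_wpM2l// ltW.
  apply: ler_wpM2l => //; apply: le_trans Sgw; rewrite (bigD1 j)//= lerDl.
  by apply: sumr_ge0 => k _; apply: int_ge0 => s _; rewrite mulr_ge0.
have SIw : \sum_j I 0 r (fun s => `|w j s|) <=
    (\sum_j K j) * (M%:R * C * `|z| * h) + M%:R * (2 * e).
  apply: (le_trans (ler_sum _ (fun j _ => Iw j))).
  by rewrite big_split/= -mulr_suml sumr_const card_ord -[X in _ + X]mulr_natl.
have bwg j : bmeas 0 r (fun s => w j s * gain y j s).
  by apply: bmeasM => //; exact: bmeas_gain.
have dote : dotv y x - dotv y (extremal z r) =
    - I 0 r (fun s => \sum_j w j s * gain y j s)
    - I r (r + h) (fun s => dotv y (ctrl u s)).
  have bs := vbmeas_ctrl A B (admissible_vbmeas (admissible_sg A B r z)).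
  rewrite dotx /extremal dotvNr (dotv_vint y bs).
  have cur := bmeas_dotv y (vbmeas_ctrl A B bur).
  rewrite (int_eq (f := fun s => \sum_j w j s * gain y j s)
    (g := fun s => dotv y (ctrl u s) -
      dotv y (ctrl (fun s => \col_j - Num.sg (gain z j s)) s))).
    by rewrite (intB cur (bmeas_dotv y bs)); ring.
  move=> s _; rewrite !dotv_ctrl -sumrB; apply: eq_bigr => j _.
  by rewrite mxE /w; ring.
have main : `|I 0 r (fun s => \sum_j w j s * gain y j s)| <=
    C * `|y| * \sum_j I 0 r (fun s => `|w j s|).
  rewrite (int_sum bwg) (le_trans (ler_norm_sum _ _ _))// mulr_sumr.
  apply: ler_sum => j _; apply: le_trans (int_norm_le (bwg j)) _.
  have bnw := bmeas_norm (bw j).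
  rewrite -(intZ _ bnw); apply: int_le; [exact: bmeas_norm|exact: bmeasZ|].
  move=> s /andP[s0 sr]; rewrite normrM mulrC ler_wpM2r//.
  by apply: HC; rewrite s0 (le_trans sr)// lerDl.
rewrite /L dote (le_trans (ler_normB _ _))// normrN.
apply: (le_trans (lerD main (tail y))).
apply: (le_trans (lerD (ler_wpM2l _ SIw) (lexx _))); first by rewrite mulr_ge0.
by rewrite /P le_eqVlt; apply/orP; left; apply/eqP; ring.
Qed.

End ReachGeometry.

(** * The minimum time function, and its infinite slope on [setS] *)

Section MinimumTime.
Variables (R : realType) (N M : nat) (A : 'M[R]_N) (B : 'M[R]_(N, M)).
Local Notation mu := (@lebesgue_measure R).
Local Notation I a b f := (Rintegral mu `[a, b] f).
Implicit Types (x y z : 'cV[R]_N).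
Local Notation reach := (reach A B).
Local Notation gain := (gain A B).
Local Notation bang := (bang A B).
Local Notation ctrl := (ctrl A B).
Local Notation supp := (supp A B).
Local Notation extremal := (extremal A B).
Local Notation T := (min_time A B).

Lemma min_time_le theta x : 0 <= theta -> reach theta x -> (T x <= theta%:E)%E.
Proof.
move=> t0 /steerP rx; apply: ereal_inf_lbound; by exists theta.
Qed.

Lemma min_time_ge0 x : (0 <= T x)%E.
Proof. by apply: le_ereal_inf_tmp => _ [t [t0 _] <-]; rewrite lee_fin. Qed.

Lemma min_time_lt theta x : (T x < theta%:E)%E -> reach theta x.
Proof.
move=> /ereal_inf_lt[_ [t [t0 /steerP rx] <-]]; rewrite lte_fin => tt.
by apply: reach_mono rx => //; exact: ltW.
Qed.

Lemma min_time_fin x : (T x < +oo)%E -> exists2 r, 0 <= r & T x = r%:E.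
Proof.
have := min_time_ge0 x; case: (T x) => // r; rewrite lee_fin => r0 _.
by exists r.
Qed.

(** The substitution [t -> r - t] turns [e^{A(t-r)}] into [e^{-As}] and [<zeta, e^{At} b_i>] into
    [gain z i s] with [z = e^{A^T r} zeta]. *)
Lemma sum_vint_extremal (zeta : 'cV[R]_N) r :
  \sum_(i < M) vint 0 r (fun t =>
     Num.sg (dotv zeta (expm A t *m col i B)) *: (expm A (t - r) *m col i B)) =
  extremal ((expm A r)^T *m zeta) r.
Proof.
set z := _ *m zeta; apply: dotv_inj => y.
have bs := vbmeas_ctrl A B (admissible_vbmeas (admissible_sg A B r z)).
rewrite dotv_sumr /extremal dotvNr (dotv_vint y bs).
have b1 a b (t : 'cV[R]_N) i :
    bmeas a b (fun s => dotv t (expm A s *m col i B)).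
  exact/bmeas_continuous/continuous_dotv_expm.
have dE i s : dotv y (expm A (s - r) *m col i B) =
    dotv ((expm A (- r))^T *m y) (expm A s *m col i B).
  by rewrite -dotv_mulmx mulmxA -expmD addrC.
have b2 i : bmeas 0 r (fun s => Num.sg (dotv zeta (expm A s *m col i B)) *
    dotv ((expm A (- r))^T *m y) (expm A s *m col i B)).
  by apply: bmeasM => //; apply: bmeas_sg; exact: (b1 0 r zeta i).1.
have b3 i : vbmeas 0 r (fun t =>
     Num.sg (dotv zeta (expm A t *m col i B)) *: (expm A (t - r) *m col i B)).
  apply: vbmeas_dotvP => t; have : bmeas 0 r (fun s =>
      Num.sg (dotv zeta (expm A s *m col i B)) *
      dotv ((expm A (- r))^T *m t) (expm A s *m col i B)).
    by apply: bmeasM => //; apply: bmeas_sg; exact: (b1 0 r zeta i).1.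
  apply: bmeas_eq => s _.
  by rewrite dotvZr -dotv_mulmx mulmxA -expmD [- r + s]addrC.
have b4 i : bmeas 0 r (fun s => Num.sg (gain z i s) * gain y i s).
  by apply: bmeasM; [apply: bmeas_sg; exact: (bmeas_gain A B 0 r z i).1|
                     exact: bmeas_gain].
rewrite (int_eq (f := fun t => dotv y (ctrl _ t))
    (g := fun s => - \sum_i Num.sg (gain z i s) * gain y i s)); last first.
  move=> s _; rewrite dotv_ctrl -sumrN; apply: eq_bigr => j _.
  by rewrite mxE mulNr.
rewrite intN ?opprK; last exact: bmeas_sum.
rewrite (int_sum b4); apply: eq_bigr => i _; rewrite (dotv_vint y (b3 i)).
rewrite (int_eq (g := fun s => Num.sg (dotv zeta (expm A s *m col i B)) *
    dotv ((expm A (- r))^T *m y) (expm A s *m col i B))); last first.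
  by move=> s _; rewrite dotvZr dE.
rewrite (int_reflect (b2 i)); apply: int_eq => s _; congr (Num.sg _ * _).
  by rewrite /gain /z -dotv_mulmx /bang mulmxA -expmD.
rewrite -dotv_mulmx mulmxA -expmD /gain /bang; congr (dotv _ (expm A _ *m _)).
by rewrite addrA addNr add0r.
Qed.

Lemma extremalZ a z r : 0 < a -> extremal (a *: z) r = extremal z r.
Proof.
move=> a0; congr (- _); apply: vint_eq => s _; congr (_ *m (_ *m _)).
by apply/colP => j; rewrite !mxE /gain dotvZl sgrM gtr0_sg// mul1r.
Qed.

(** Under [z = e^{A^T r} zeta], [gain z j r] equals [<zeta, b_j>]. Extremal points are unchanged by
    positive scaling of [z], so a nonzero vector serves as well as a unit one. *)
Lemma setS_extremal x : setS A B x <-> exists r z, [/\ 0 < r, z != 0,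
  x = extremal z r & forall j, gain z j r = 0].
Proof.
split.
  move=> [r [zeta [r0 [z1 [-> zb]]]]].
  exists r, ((expm A r)^T *m zeta); split=> //.
  - apply/eqP => /(congr1 (mulmx (expm A (- r))^T)).
    rewrite mulmxA -trmx_mul expmNK trmx1 mul1mx mulmx0 => z0.
    by move/eqP: z1; rewrite z0 dotv0l eq_sym oner_eq0.
  - exact: sum_vint_extremal.
  - by move=> j; rewrite /gain -dotv_mulmx /bang mulmxA expmNK mul1mx.
move=> [r [z [r0 z0 -> zb]]]; pose w := (expm A (- r))^T *m z.
have zE : z = (expm A r)^T *m w.
  by rewrite /w mulmxA -trmx_mul expmKN trmx1 mul1mx.
have w0 : w != 0 by apply: contraNneq z0 => w0; rewrite zE w0 mulmx0.
have d0 := dotv_gt0 w0; set d := dotv w w in d0.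
have q0 : 0 < Num.sqrt d by rewrite sqrtr_gt0.
exists r, ((Num.sqrt d)^-1 *: w); split=> //; split; [|split].
- rewrite dotvZl dotvZr -/d mulrA -invfM -expr2 sqr_sqrtr; last exact: ltW.
  by rewrite mulVf// gt_eqF.
- by rewrite sum_vint_extremal -scalemxAr -zE extremalZ// invr_gt0.
- by move=> i; rewrite dotvZl /w -dotv_mulmx -/(bang i r) -/(gain z i r) zb mulr0.
Qed.

Lemma setS_non_lipschitz x : setS A B x -> non_lipschitz_at T x.
Proof.
move=> /setS_extremal[r [z [r0 z0 xE zb]]].
have rx : reach r x by rewrite xE; exact: reach_extremal.
have Tx := min_time_le (ltW r0) rx.
have [r' r'0 TxE] : exists2 r', 0 <= r' & T x = r'%:E.
  by apply: min_time_fin; apply: le_lt_trans Tx (ltry _).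
have r'r : r' <= r by rewrite TxE lee_fin in Tx.
have nz : 0 < `|z| by rewrite normr_gt0.
have key (K : R) : 0 < K -> \forall n \near \oo,
    ~ reach (r + K * n.+1%:R^-1) (x + n.+1%:R^-1 *: z).
  move=> K0; have zz := dotv_gt0 z0.
  (* If every [|gain z j|] is at most [eta] on [[r, r + K * h]], the support function grows there by
     at most [h * eta * K * M], less than the [h * <z, z>] that reaching [x + h z] would require. *)
  pose eta := dotv z z / (K * M%:R + 1) / 2.
  have KM : 0 < K * M%:R + 1 by rewrite ltr_wpDl// mulr_ge0// ltW.
  have eta0 : 0 < eta by rewrite !divr_gt0.
  have cg j : \forall s \near r, `|gain z j s| <= eta.
    have := @continuous_gain _ _ _ A B z j r => /cvgrPdist_le /(_ _ eta0).
    by apply: filterS => s; rewrite zb sub0r normrN.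
  have [d /= d0 Hd] := filter_forall _ cg.
  have dK : 0 < d / K by rewrite divr_gt0.
  near=> n => rn; set h := n.+1%:R^-1 in rn *.
  have h0 : 0 < h by rewrite invr_gt0.
  have Kh : K * h < d.
    rewrite mulrC -ltr_pdivlMr// /h; near: n.
    exact: (near_infty_natSinv_lt (PosNum dK)).
  have := reach_dotv_le z rn; rewrite dotvDr dotvZr {1}xE dotv_extremal.
  have rK : r <= r + K * h by rewrite lerDl mulr_ge0// ltW.
  rewrite -lerBrDl (suppB _ _ _ (ltW r0) rK).
  have : \sum_j I r (r + K * h) (fun s => `|gain z j s|) <=
      \sum_(j < M) eta * (r + K * h - r).
    apply: ler_sum => j _; rewrite -int_cst//.
    apply: int_le; [exact: bmeas_normgain|exact: bmeas_cst|].
    move=> s /andP[rs sr]; apply: Hd; rewrite /ball_/= distrC ger0_norm ?subr_ge0//.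
    by rewrite (le_lt_trans _ Kh)// lerBlDl.
  rewrite sumr_const card_ord -[X in _ <= X]mulr_natl => H1 H2.
  have := le_trans H2 H1.
  have -> : M%:R * (eta * (r + K * h - r)) = h * (eta * (K * M%:R)) by ring.
  rewrite ler_pM2l//; apply/negP; rewrite -ltNge.
  apply: (@lt_trans _ _ (eta * (K * M%:R + 1))).
    by rewrite ltr_pM2l// ltrDl.
  rewrite /eta mulrAC divfK ?gt_eqF//; lra.
exists (fun=> x), (fun n => x + n.+1%:R^-1 *: z).
split; first exact: cvg_cst.
split.
  rewrite -[X in _ --> X]addr0; apply: cvgD; first exact: cvg_cst.
  rewrite -[X in _ --> X](scale0r z); apply: cvgZr_tmp; exact: cvg_harmonic.
split.
  move=> n; rewrite eq_sym -subr_eq0 addrAC subrr add0r scaler_eq0 (negbTE z0) orbF.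
  by rewrite invr_eq0 pnatr_eq0.
apply: (cvg_limn_einf_sup _).2; apply/cvgeyPger => K _.
(* The increment has norm [h * |z|], so a time cost [K1 * h] yields a quotient of at least [K]. This
   cost is counted from [r], which is at least [T x]. *)
pose K1 := `|K| * `|z| + 1.
have K10 : 0 < K1 by rewrite ltr_wpDl// mulr_ge0.
near=> n; have : ~ reach (r + K1 * n.+1%:R^-1) (x + n.+1%:R^-1 *: z).
  by near: n; exact: key.
set y := x + _; set h := n.+1%:R^-1 => nr.
have h0 : 0 < h by rewrite invr_gt0.
have Ty : ((r + K1 * h)%:E <= T y)%E.
  by rewrite leNgt; apply/negP => /min_time_lt.
have H : ((K1 * h)%:E <= `|T y - T x|)%E.
  rewrite TxE; case: (T y) Ty => [t||]//=; rewrite ?lee_fin ?leey// => Ht.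
  by rewrite (le_trans _ (ler_norm _))//; lra.
have -> : `|y - x| = h * `|z|.
  by rewrite /y addrAC subrr add0r normrZ gtr0_norm.
have hz : 0 < (h * `|z|)^-1 by rewrite invr_gt0 mulr_gt0.
apply: (@le_trans _ _ ((K1 * h)%:E * ((h * `|z|)^-1)%:E)%E); last first.
  by rewrite lee_wpmul2r// lee_fin ltW.
rewrite -EFinM lee_fin ler_pdivlMr ?mulr_gt0//.
have : K * (h * `|z|) <= `|K| * (h * `|z|).
  by rewrite ler_wpM2r ?ler_norm// mulr_ge0// ltW.
by rewrite /K1; lra.
Unshelve. all: by end_near. Qed.

End MinimumTime.

(** * From failure of the Lipschitz property to membership in [setS] *)

Section NonLipschitzPoints.
Variables (R : realType) (N M : nat) (A : 'M[R]_N) (B : 'M[R]_(N, M)).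
Hypothesis M_gt0 : (0 < M)%N.
Hypothesis kalmanB : forall j, \rank (kalman A (col j B)) = N.
Local Notation mu := (@lebesgue_measure R).
Local Notation I a b f := (Rintegral mu `[a, b] f).
Implicit Types (x y z : 'cV[R]_N).
Local Notation reach := (reach A B).
Local Notation gain := (gain A B).
Local Notation bang := (bang A B).
Local Notation supp := (supp A B).
Local Notation extremal := (extremal A B).
Local Notation T := (min_time A B).

(** [reach_perturb] is used in both directions: from [x] at time [r + e / 2] it bounds [T y] by
    [r + e], while [T y < r - e] would bring [x] to the origin by time [r - e / 2]. *)
Lemma min_time_continuous x (r e : R) : T x = r%:E -> 0 < e -> e <= r ->
  exists2 d, 0 < d & forall y, `|y - x| < d ->
  exists2 t, T y = t%:E & r - e <= t <= r + e.
Proof.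
move=> Tx e0 er; have e20 : 0 < e / 2 by rewrite divr_gt0.
have re20 : 0 <= r + e / 2 by lra.
have re0 : 0 <= r - e by lra.
pose j0 := Ordinal M_gt0.
have [d1 d10 H1] := reach_perturb (kalmanB j0) re20 e20.
have [d2 d20 H2] := reach_perturb (kalmanB j0) re0 e20.
exists (Num.min d1 d2); first by rewrite lt_min d10.
move=> y; rewrite lt_min => /andP[yd1 yd2].
have ry : reach (r + e) y.
  have rx : reach (r + e / 2) x by apply: min_time_lt; rewrite Tx lte_fin; lra.
  by have := H1 _ _ rx yd1; rewrite subrKC -addrA -splitr.
have Ty : (T y <= (r + e)%:E)%E by apply: min_time_le ry; lra.
have [t t0 TyE] := min_time_fin (le_lt_trans Ty (ltry _)).
exists t => //; rewrite TyE lee_fin in Ty; rewrite Ty andbT leNgt.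
apply/negP => tr.
have ry' : reach (r - e) y by apply: min_time_lt; rewrite TyE lte_fin.
have xyd : `|x - y| < d2 by rewrite distrC.
have := H2 _ _ ry' xyd; rewrite subrKC => rx.
have := min_time_le _ rx; rewrite Tx lee_fin => /(_ ltac:(lra)); lra.
Qed.

(** If [T x] were 0, [x] would lie in [reach h] for all small [h], a set of size [O(h)]. *)
Lemma min_time_gt0 x (r : R) : T x = r%:E -> x != 0 -> 0 < r.
Proof.
move=> Tx x0; have := min_time_ge0 A B x; rewrite Tx lee_fin le_eqVlt.
case/orP => // /eqP r0; have [C C0 HC] := reach_norm_le A B 1.
have : `|x| <= 0.
  apply: (@le_affine_limit _ _ C) => // h /andP[h0 h1]; rewrite addr0.
  apply: HC; first by rewrite (ltW h0).
  by apply: min_time_lt; rewrite Tx -r0 lte_fin.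
by rewrite normr_le0 (negbTE x0).
Qed.

(** By [reach_perturb] a neighbourhood of [reach theta] is reachable within half of the gap
    [t - theta], hence before [t]. So [y] keeps a positive distance from [reach theta] and can be
    separated from it. *)
Lemma min_time_normal y (t theta : R) : T y = t%:E -> 0 <= theta -> theta < t ->
  exists2 z, `|z| = 1 & supp z theta <= dotv z y.
Proof.
move=> Ty th0 tht; have e0 : 0 < (t - theta) / 2 by lra.
have [d d0 Hd] := reach_perturb (kalmanB (Ordinal M_gt0)) th0 e0.
have [C C0 HC] := reach_norm_le A B theta.
have [||||v v0 Hv] := @convex_separation _ _ (reach theta) y (C * theta) d _ _ _ d0.
- by move=> p q s; exact: reach_convex.
- by exists (extremal 0 theta); exact: reach_extremal.
- by move=> p rp; apply: HC => //; rewrite th0 lexx.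
- move=> p rp; rewrite leNgt; apply/negP => yp.
  have := Hd _ _ rp yp; rewrite subrKC => ry.
  have := min_time_le _ ry; rewrite Ty lee_fin => /(_ ltac:(lra)); lra.
have nv : 0 < `|v| by rewrite normr_gt0.
exists (`|v|^-1 *: v).
  by rewrite normrZ ger0_norm ?invr_ge0// mulVf// gt_eqF.
rewrite -dotv_extremal !dotvZl ler_pM2l ?invr_gt0//.
by apply: Hv; exact: reach_extremal.
Qed.

Lemma gain_equicontinuous (r e : R) : 0 < e -> exists2 d, 0 < d &
  forall z j s, `|z| <= 1 -> `|s - r| <= d -> `|gain z j s - gain z j r| <= e.
Proof.
move=> e0; have Ne : 0 < e / (N%:R + 1) by rewrite divr_gt0// ltr_wpDl.
have H j : \forall s \near r, `|bang j s - bang j r| <= e / (N%:R + 1).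
  have Hi i : \forall s \near r, `|bang j s i 0 - bang j r i 0| <= e / (N%:R + 1).
    have := @continuous_gain _ _ _ A B (delta_mx i 0) j r.
    move=> /cvgrPdist_le /(_ _ Ne); apply: filterS => s.
    by rewrite distrC /gain -!coord_dotv.
  apply: filterS (filter_forall (nbhs_filter r) Hi) => s Hs.
  apply: mx_norm_le => [|i k]; first exact: ltW.
  rewrite ord1 mxE [X in _ + X]mxE; exact: Hs.
have [d /= d0 Hd] := filter_forall _ H.
exists (d / 2); first by rewrite divr_gt0.
move=> z j s z1 sr; rewrite -dotvBr (le_trans (dotv_norm_le _ _))//.
apply: (@le_trans _ _ (N%:R * 1 * (e / (N%:R + 1)))).
  rewrite ler_pM// ?mulr_ge0// ?ler_wpM2l//; apply: Hd.
  by rewrite /ball_/= distrC; lra.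
by rewrite mulr1 mulrA ler_pdivrMr ?ltr_wpDl//; nra.
Qed.

(** [T] is an infimum, so [x] is taken in [reach (r + h)] for [h > 0], and continuity of [supp z] in
    time carries the bound to [r]. *)
Lemma dotv_le_supp x (r : R) z : T x = r%:E -> dotv z x <= supp z r.
Proof.
move=> Tx; have r0 : 0 <= r by rewrite -lee_fin -Tx min_time_ge0.
have [C C0 HC] := supp_lipschitz A B (r + 1).
apply: (@le_affine_limit _ _ (C * `|z|)); first by rewrite mulr_ge0.
move=> h /andP[h0 h1].
have rx : reach (r + h) x by apply: min_time_lt; rewrite Tx lte_fin ltrDl.
have := HC z r (r + h) r0; rewrite lerDl lerD2l (ltW h0) h1 => /(_ isT isT).
have := reach_dotv_le z rx; lra.
Qed.

(* Take two nearby points with a large difference quotient of [T]; [z] separates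
   the farther one from a reachable set of slightly smaller time. *)
Lemma almost_normal x (r e : R) : T x = r%:E -> 0 < r -> 0 < e ->
  non_lipschitz_at T x ->
  exists2 z, `|z| = 1 &
    \sum_j `|gain z j r| + (supp z r - dotv z x) <= e.
Proof.
move=> Tx r0 e0 [xs [ys [xsx [ysx [xys limxy]]]]].
have M0 : 0 < M%:R :> R by rewrite ltr0n.
have e1 : 0 < e / 4 / M%:R by rewrite !divr_gt0.
have [d1 d10 Hd1] := gain_equicontinuous r e1.
have [C C0 HC] := supp_lipschitz A B (r + r).
(* Within [e2] of [r], each gain varies by at most [e / 4 / M], the support function by at most
   [e / 4], and times stay nonnegative. *)
pose e2 := Num.min (Num.min d1 r) (e / 4 / (C + 1)).
have C1 : 0 < C + 1 by rewrite ltr_wpDl.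
have e20 : 0 < e2 by rewrite !lt_min d10 r0 !divr_gt0.
have e2d : e2 <= d1 by rewrite !ge_min lexx.
have e2r : e2 <= r by rewrite !ge_min lexx orbT.
have e2C : C * e2 <= e / 4.
  have : e2 <= e / 4 / (C + 1) by rewrite !ge_min lexx !orbT.
  by rewrite ler_pdivlMr//; nra.
have [d2 d20 Hd2] := min_time_continuous Tx e20 e2r.
have N1 : 0 < N%:R + 1 :> R by rewrite ltr_wpDl.
pose d := Num.min d2 (e / 4 / (N%:R + 1)).
have d0 : 0 < d by rewrite lt_min d20 !divr_gt0.
have dd2 : d <= d2 by rewrite ge_min lexx.
have dN : N%:R * d <= e / 4.
  have : d <= e / 4 / (N%:R + 1) by rewrite ge_min lexx orbT.
  by rewrite ler_pdivlMr//; nra.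
(* With this slope, [K * |p - q| < D] gives [N * |p - q| <= (D / 2) * (e / 4)]. *)
pose K := 8 * (N%:R + 1) / e.
have K0 : 0 < K by rewrite divr_gt0// mulr_gt0.
pose V := [set i | `|xs i - x| < d /\ `|ys i - x| < d].
have [i [xi yi] Hi] : exists2 i, V i &
    (K%:E < `|T (ys i) - T (xs i)| * (`|ys i - xs i|^-1)%:E)%E.
  have nV : \forall i \near \oo, V i.
    near=> i; split; near: i.
      by move/cvgrPdist_lt: xsx => /(_ _ d0); apply: filterS => i; rewrite distrC.
    by move/cvgrPdist_lt: ysx => /(_ _ d0); apply: filterS => i; rewrite distrC.
  have : (K%:E < ereal_sup [set (`|T (ys i) - T (xs i)| *
      (`|ys i - xs i|^-1)%:E)%E | i in V])%E.
    apply: (@lt_le_trans _ _ +oo%E); first exact: ltry.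
    by rewrite -limxy; apply: ereal_inf_lbound; exists V.
  by move=> /ereal_sup_gt[_ [i Vi <-] Hi]; exists i.
(* The two points are ordered so that [p] has the larger minimum time. *)
have [p [q [tp [tq [pd qd Tp Tq [ptq Kpq]]]]]] : exists p q (tp tq : R),
    [/\ `|p - x| < d, `|q - x| < d, T p = tp%:E, T q = tq%:E & tq < tp /\
    K * `|p - q| < tp - tq].
  have [ty Ty _] := Hd2 _ (lt_le_trans yi dd2).
  have [tx Tx' _] := Hd2 _ (lt_le_trans xi dd2).
  move: Hi; rewrite Ty Tx' -EFinB abse_EFin -EFinM lte_fin.
  have nxy : 0 < `|ys i - xs i| by rewrite normr_gt0 subr_eq0 eq_sym.
  rewrite ltr_pdivlMr//; have [xy|xy] := ltP tx ty.
    rewrite gtr0_norm ?subr_gt0// => H.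
    by exists (ys i), (xs i), ty, tx.
  rewrite ler0_norm ?subr_le0// opprB distrC => H.
  exists (xs i), (ys i), tx, ty; split => //; split => //.
  by rewrite -subr_gt0 (lt_trans _ H)// mulr_gt0// distrC.
have [tp' Tp' Hp] := Hd2 _ (lt_le_trans pd dd2).
have [tq' Tq' Hq] := Hd2 _ (lt_le_trans qd dd2).
move: Tp' Tq'; rewrite Tp Tq => -[tpE] -[tqE]; subst tp' tq'.
(* [th < T p] permits separation of [p], [t1 > T q] makes [q] reachable, and an interval of length
   [D / 2] remains between them. *)
pose D := tp - tq; pose th := tp - D / 4; pose t1 := tq + D / 4.
have D0 : 0 < D by rewrite subr_gt0.
have th0 : 0 <= th by rewrite /th /D; lra.
have t10 : 0 <= t1 by rewrite /t1 /D; lra.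
have thp : th < tp by rewrite /th; lra.
have t1th : t1 <= th by rewrite /t1 /th /D; lra.
have [z z1 Hz] := min_time_normal Tp th0 thp.
exists z => //.
have rq : reach t1 q by apply: min_time_lt; rewrite Tq lte_fin /t1; lra.
have Hq1 := reach_dotv_le z rq.
have pq : dotv z p - dotv z q <= N%:R * `|p - q|.
  rewrite -dotvBr (le_trans (ler_norm _))// (le_trans (dotv_norm_le _ _))//.
  by rewrite z1 mulr1.
have px : dotv z p - dotv z x <= N%:R * d.
  rewrite -dotvBr (le_trans (ler_norm _))// (le_trans (dotv_norm_le _ _))//.
  by rewrite z1 mulr1 ler_wpM2l// ltW.
have S1 : supp z r - supp z th <= C * e2.
  have [rth|thr] := leP r th.
    apply: (@le_trans _ _ 0); last by rewrite mulr_ge0// ltW.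
    by rewrite subr_le0 supp_mono// ltW.
  apply: (le_trans (HC z th r th0 (ltW thr) _)); first lra.
  by rewrite z1 mulr1 ler_wpM2l// /th /D; lra.
have S2 : (D / 2) * (\sum_j `|gain z j r| - e / 4) <= supp z th - supp z t1.
  rewrite (suppB _ _ _ t10 t1th).
  have -> : e / 4 = \sum_(j < M) e / 4 / M%:R.
    by rewrite sumr_const card_ord -[RHS]mulr_natr divfK ?gt_eqF.
  rewrite -sumrB mulr_sumr; apply: ler_sum => j _.
  have -> : D / 2 * (`|gain z j r| - e / 4 / M%:R) =
      (`|gain z j r| - e / 4 / M%:R) * (th - t1).
    by rewrite mulrC; congr (_ * _); rewrite /th /t1 /D; lra.
  rewrite -int_cst//; apply: int_le; [exact: bmeas_cst|exact: bmeas_normgain|].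
  move=> s /andP[ts sth].
  have sr : `|s - r| <= d1.
    by rewrite ler_norml; move: ts sth; rewrite /t1 /th /D; lra.
  have := Hd1 z j s; rewrite z1 => /(_ (lexx _) sr).
  have := lerB_dist (gain z j r) (gain z j s); rewrite distrC; lra.
have S3 : N%:R * `|p - q| <= D / 2 * (e / 4).
  have KE : K * e = 8 * (N%:R + 1) by rewrite /K divfK ?gt_eqF.
  have H : N%:R * (K * `|p - q|) * e <= N%:R * D * e.
    by rewrite ler_pM2r// ler_wpM2l// ltW.
  have E : N%:R * (K * `|p - q|) * e = N%:R * `|p - q| * (K * e) by ring.
  rewrite E KE in H.
  have NN : N%:R <= N%:R + 1 :> R by rewrite lerDl.
  have H2 : N%:R * D * e <= (N%:R + 1) * D * e.
    by rewrite ler_pM2r// ler_pM2r.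
  have : (N%:R + 1) * (8 * (N%:R * `|p - q|)) <= (N%:R + 1) * (D * e) by lra.
  by rewrite ler_pM2l//; lra.
have S4 : \sum_j `|gain z j r| <= e / 2.
  have : D / 2 * (\sum_j `|gain z j r| - e / 4) <= D / 2 * (e / 4) by lra.
  by rewrite ler_pM2l ?divr_gt0//; lra.
(* The gains take [e / 2] by [S4]; [supp z r - <z, x>] takes [e / 4] from [S1], nothing from the
   separation [Hz], and [e / 4] from [px] and [dN]. *)
lra.
Unshelve. all: by end_near. Qed.

(** The functional [phi] bounded in [almost_normal] is Lipschitz in [z], so it attains its minimum
    on the compact unit sphere, and this minimum is at most 0. Both terms of [phi] are nonnegative,
    hence both vanish there. *)
Lemma exact_normal x (r : R) : T x = r%:E -> 0 < r -> non_lipschitz_at T x ->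
  exists2 z, z != 0 & supp z r <= dotv z x /\ forall j, gain z j r = 0.
Proof.
move=> Tx r0 nl.
pose phi z := \sum_j `|gain z j r| + (supp z r - dotv z x).
have [C1 C10 HC1] := gain_le A B r.
have [C2 C20 HC2] := supp_lipschitz_l A B (ltW r0).
pose C := M%:R * C1 + C2 + N%:R * `|x|.
have C0 : 0 <= C by rewrite !addr_ge0// mulr_ge0.
have phi_lip z z' : phi z - phi z' <= C * `|z - z'|.
  have H1 : \sum_j `|gain z j r| - \sum_j `|gain z' j r| <= M%:R * C1 * `|z - z'|.
    rewrite -sumrB; apply: (@le_trans _ _ (\sum_(j < M) C1 * `|z - z'|)).
      apply: ler_sum => j _; rewrite (le_trans (lerB_dist _ _))// -dotvBl.
      by apply: HC1; rewrite (ltW r0) lexx.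
    by rewrite sumr_const card_ord -[leLHS]mulr_natl mulrA.
  have H2 := HC2 z z'.
  have H3 : dotv z' x - dotv z x <= N%:R * `|x| * `|z - z'|.
    rewrite -dotvBl (le_trans (ler_norm _))// (le_trans (dotv_norm_le _ _))//.
    by rewrite mulrAC distrC.
  by rewrite /phi /C; lra.
have phi_cont : continuous (fun v : 'rV[R]_N => phi v^T).
  move=> v; apply/(@cvgrPdist_le _ _ _ (nbhs v) (nbhs_filter v)) => e e0.
  have C1' : 0 < C + 1 by rewrite ltr_wpDl.
  have nv : nbhs v (ball v (e / (C + 1))).
    by apply: nbhsx_ballx; rewrite divr_gt0.
  apply: filterS nv => w; rewrite -ball_normE /= => /ltW.
  rewrite ler_pdivlMr// => vw.
  have tr (a b : 'rV[R]_N) : `|a^T - b^T| <= `|a - b|.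
    apply: mx_norm_le => // i j.
    by have := norm_coord_le (a - b) j i; rewrite !mxE.
  have CC : C * `|v - w| <= e.
    by apply: le_trans vw; have := normr_ge0 (v - w); nra.
  rewrite /= ler_norml; apply/andP; split.
    rewrite lerNl opprB; apply: le_trans (phi_lip _ _) _.
    by apply: le_trans CC; rewrite ler_wpM2l// (le_trans (tr _ _))// distrC.
  apply: le_trans (phi_lip _ _) _.
  by apply: le_trans CC; rewrite ler_wpM2l//.
pose S := [set v : 'rV[R]_N | `|v| = 1].
have trn n m (w : 'M[R]_(n, m)) : `|w^T| = `|w|.
  apply/eqP; rewrite eq_le; apply/andP; split; apply: mx_norm_le => // i j.
    by rewrite mxE norm_coord_le.
  by have := norm_coord_le w^T j i; rewrite mxE.
have cS : compact S.
  apply: bounded_closed_compact.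
    exists 1; split; first exact: num_real.
    by move=> y y1 v /= ->; exact: ltW.
  rewrite (_ : S = (fun v => `|v|) @^-1` [set 1])//.
  apply: preimage_closed; last exact: closed_eq.
  by move=> v _; exact: norm_continuous.
have [c /set_mem cS1 Hc] : exists2 c, c \in S & forall v, v \in S -> phi c^T <= phi v^T.
  apply: EVT_min_rV => //.
    have [z z1 _] := almost_normal Tx r0 ltr01 nl.
    by exists z^T; rewrite /S/= trn.
  exact: continuous_subspaceT.
have phi0 : phi c^T <= 0.
  apply: (@le_affine_limit _ _ 1) => // h /andP[h0 _]; rewrite mul1r addr0.
  have [z z1 Hz] := almost_normal Tx r0 h0 nl.
  have zS : z^T \in S by rewrite inE /S/= trn.
  by have := Hc _ zS; rewrite trmxK => /le_trans; apply.
have S0 : 0 <= \sum_j `|gain c^T j r| by exact: sumr_ge0.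
have supp0 := dotv_le_supp c^T Tx.
exists c^T.
  by rewrite -normr_eq0 trn cS1 oner_eq0.
rewrite /phi in phi0; split; first lra.
move=> j; apply/eqP; rewrite -normr_le0.
apply: le_trans (_ : \sum_j `|gain c^T j r| <= 0); last lra.
by rewrite (bigD1 j)//= lerDl sumr_ge0.
Qed.

Lemma non_lipschitz_setS x : x != 0 -> (T x < +oo)%E ->
  non_lipschitz_at T x -> setS A B x.
Proof.
move=> x0 /min_time_fin[r r0 Tx] nl; have {}r0 := min_time_gt0 Tx x0.
have [z z0 [sz zb]] := exact_normal Tx r0 nl.
apply/setS_extremal; exists r, z; split=> //.
apply: reach_unique => //; first exact: ltW.
by move=> t rt; apply: min_time_lt; rewrite Tx lte_fin.
Qed.

End NonLipschitzPoints.

(** * Trajectories with vanishing Hamiltonian *)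

Section VanishingHamiltonian.
Variables (R : realType) (N M : nat) (A : 'M[R]_N) (B : 'M[R]_(N, M)).
Local Notation mu := (@lebesgue_measure R).
Local Notation I a b f := (Rintegral mu `[a, b] f).
Implicit Types (z : 'cV[R]_N).

Lemma dotv_mulmx_cols z (w : 'cV[R]_M) :
  dotv z (B *m w) = \sum_j w j 0 * dotv z (col j B).
Proof.
by rewrite mulmx_cols dotv_sumr; apply: eq_bigr => j _; rewrite dotvZr.
Qed.

Lemma mul_ge_Nnorm (a g : R) : -1 <= a <= 1 -> - `|g| <= a * g.
Proof.
move=> a1; rewrite lerNl (le_trans (ler_norm _))// normrN normrM ler_piMl//.
by rewrite ler_norml.
Qed.

Lemma inf_dotv_cube z :
  inf [set dotv z (B *m w) | w in @cube R M] = - \sum_j `|dotv z (col j B)|.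
Proof.
set S := [set _ | w in _].
have lb : lbound S (- \sum_j `|dotv z (col j B)|).
  move=> _ [w w1 <-]; rewrite dotv_mulmx_cols -sumrN; apply: ler_sum => j _.
  exact: mul_ge_Nnorm.
pose w0 : 'cV[R]_M := \col_j - Num.sg (dotv z (col j B)).
have Sw : S (- \sum_j `|dotv z (col j B)|).
  exists w0.
    by move=> j; rewrite mxE -ler_norml normrN normr_sg lern1 leq_b1.
  rewrite dotv_mulmx_cols -sumrN; apply: eq_bigr => j _.
  by rewrite mxE mulNr normrEsg.
apply/eqP; rewrite eq_le; apply/andP; split.
  by apply: ge_inf => //; exists (- \sum_j `|dotv z (col j B)|).
by apply: lb_le_inf => //; eexists; exact: Sw.
Qed.

(** Each summand [w_j g_j + |g_j|], with [g_j = <z, b_j>], is nonnegative; equality with the minimum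
    makes their sum, hence each of them, zero. *)
Lemma dotv_eq_inf_cube z (w : 'cV[R]_M) : cube w ->
  dotv z (B *m w) = inf [set dotv z (B *m w) | w in @cube R M] ->
  forall j, dotv z (col j B) != 0 -> w j 0 = - Num.sg (dotv z (col j B)).
Proof.
rewrite inf_dotv_cube dotv_mulmx_cols => w1 /eqP.
rewrite -subr_eq0 opprK -big_split/= psumr_eq0 => [/allP H j zj|j _]; last first.
  by rewrite -lerBlDr sub0r mul_ge_Nnorm.
have := H j (mem_index_enum _) => /=.
case: (sgrP (dotv z (col j B))) => g0; first by rewrite g0 eqxx in zj.
- by rewrite -{2}[dotv _ _]mul1r -mulrDl mulf_eq0 (gt_eqF g0) orbF addr_eq0 => /eqP.
- move=> /eqP E; have /eqP : (w j 0 - 1) * dotv z (col j B) = 0 by lra.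
  by rewrite mulf_eq0 (lt_eqF g0) orbF subr_eq0 opprK => /eqP.
Qed.

Lemma rev_sol0 u : rev_sol A B u 0 = 0.
Proof.
apply/colP => i; rewrite !mxE set_itv1 Rintegral_set1 oppr0 //.
Qed.

Lemma vanishing_hamiltonian_setS theta u :
  (forall i, \rank (kalman A (col i B)) = N) ->
  admissible theta u -> vanishing_hamiltonian A B theta u ->
  forall t, 0 < t <= theta -> setS A B (rev_sol A B u t).
Proof.
(* The vector [l0] below is [lambda(0)], and [lambda(s) = e^{A^T s} l0]. *)
move=> rk au [nu [nu0 [_ [lmin lham]]]] t /andP[t0 tth].
have th0 : 0 <= theta by rewrite (le_trans _ tth)// ltW.
pose l0 := (expm A (- theta))^T *m nu.
have lE s : expm A^T (s - theta) *m nu = (expm A s)^T *m l0.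
  by rewrite expm_tr /l0 mulmxA -trmx_mul -expmD addrC.
have l00 : l0 != 0.
  apply/eqP => /(congr1 (mulmx (expm A theta)^T)).
  rewrite mulmxA -trmx_mul expmKN trmx1 mul1mx mulmx0 => z0.
  by rewrite z0 eqxx in nu0.
(* The state at time 0 is the origin, so the Hamiltonian there is [- \sum_i |<l0, b_i>|]. *)
have zb i : dotv l0 (col i B) = 0.
  have := lham 0; rewrite lexx th0 => /(_ isT).
  rewrite /ham_min rev_sol0 mulmx0 dotv0r add0r inf_dotv_cube lE expm0 trmx1 mul1mx.
  move/eqP; rewrite oppr_eq0 psumr_eq0 => [/allP H|j _]; last by [].
  by apply/eqP; rewrite -normr_eq0; exact: H (mem_index_enum _).
have l0n := dotv_gt0 l00; set d := dotv l0 l0 in l0n.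
have q0 : 0 < Num.sqrt d by rewrite sqrtr_gt0.
(* The normalized initial adjoint vector is a witness for every [t]; only the duration changes. *)
exists t, ((Num.sqrt d)^-1 *: l0); split=> //; split; [|split].
- rewrite dotvZl dotvZr -/d mulrA -invfM -expr2 sqr_sqrtr; last exact: ltW.
  by rewrite mulVf// gt_eqF.
- have b1 (y : 'cV[R]_N) i : bmeas 0 t (fun s => dotv y (expm A s *m col i B)).
    exact/bmeas_continuous/continuous_dotv_expm.
  have dE (y : 'cV[R]_N) i s : dotv y (expm A (s - t) *m col i B) =
      dotv ((expm A (- t))^T *m y) (expm A s *m col i B).
    by rewrite -dotv_mulmx mulmxA -expmD addrC.
  have b2 (y : 'cV[R]_N) i : bmeas 0 t (fun s => dotv y (expm A (s - t) *m col i B)).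
    by apply: bmeas_eq (b1 ((expm A (- t))^T *m y) i) => s _; exact: esym (dE y i s).
  have bsg i : bmeas 0 t (fun s => Num.sg (dotv l0 (expm A s *m col i B))).
    by apply: bmeas_sg; exact: (b1 l0 i).1.
  have bu : vbmeas 0 t u.
    by move=> j; apply: bmeasS (admissible_vbmeas au j).
  have ub s (y : 'cV[R]_N) : dotv y (expm A (s - t) *m (B *m u s)) =
      \sum_j u s j 0 * dotv y (expm A (s - t) *m col j B).
    rewrite (mulmx_cols B) mulmx_sumr dotv_sumr; apply: eq_bigr => j _.
    by rewrite -scalemxAr dotvZr.
  have bv y : bmeas 0 t (fun s => dotv y (expm A (s - t) *m (B *m u s))).
    have : bmeas 0 t (fun s => \sum_j u s j 0 * dotv y (expm A (s - t) *m col j B)).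
      by apply: bmeas_sum => j; apply: bmeasM.
    by apply: bmeas_eq => s _; rewrite ub.
  have bs (y : 'cV[R]_N) i : bmeas 0 t (fun s => Num.sg (dotv l0 (expm A s *m col i B)) *
      dotv y (expm A (s - t) *m col i B)) by exact: bmeasM.
  have sgE i s : Num.sg (dotv ((Num.sqrt d)^-1 *: l0) (expm A s *m col i B)) =
      Num.sg (dotv l0 (expm A s *m col i B)).
    by rewrite dotvZl sgrM gtr0_sg ?mul1r// invr_gt0.
  have bvs i : vbmeas 0 t (fun s =>
      Num.sg (dotv ((Num.sqrt d)^-1 *: l0) (expm A s *m col i B)) *:
      (expm A (s - t) *m col i B)).
    apply: vbmeas_dotvP => y; apply: bmeas_eq (bs y i) => s _.
    by rewrite dotvZr sgE.
  apply: dotv_inj => y; rewrite /rev_sol dotvNr dotv_vint; last exact: vbmeas_dotvP.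
  rewrite dotv_sumr -(intN (bv y)).
  under [RHS]eq_bigr => i _ do rewrite (dotv_vint y (bvs i)).
  rewrite -int_sum; last by move=> i; exact: bmeas_dotv.
  apply: int_ae_eq; [exact: bmeasN|by apply: bmeas_sum => i; exact: bmeas_dotv|].
  have cz : countable (\bigcup_(i in [set: 'I_M])
      [set s | dotv l0 (expm A s *m col i B) = 0]).
    apply: bigcup_countable => // i _; exact: countable_zeros_dotv_expm.
  have [S1 [mS1 S10 sub1]] := countable_ae cz.
  have [S2 [mS2 S20 sub2]] := lmin.
  (* Off this null set every switching function is nonzero and the minimum condition holds, which
     determines [u s]. *)
  exists (S1 `|` S2); split; [exact: measurableU|exact: null_set_setU|].
  move=> s Hs; apply: contrapT => /not_orP[n1 n2].
  have {}n1 i : dotv l0 (expm A s *m col i B) != 0.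
    by apply/eqP => E; apply: n1; apply: sub1 => H; apply: H; exists i.
  have {}n2 : 0 <= s <= theta -> dotv (expm A^T (s - theta) *m nu) (B *m u s) =
      inf [set dotv (expm A^T (s - theta) *m nu) (B *m w) | w in @cube R M].
    by apply: contrapT => H; apply: n2; apply: sub2.
  apply: Hs => /andP[s0 st]; have sth : 0 <= s <= theta by rewrite s0 (le_trans st).
  have cu : cube (u s) by move=> j; exact: au.2.
  have uE := dotv_eq_inf_cube cu (n2 sth).
  rewrite ub -sumrN; apply: eq_bigr => i _; rewrite dotvZr sgE.
  by rewrite uE lE -dotv_mulmx ?n1// mulNr opprK.
- by move=> i; rewrite dotvZl zb mulr0.
Qed.

End VanishingHamiltonian.

Theorem theorem4p4 (R : realType) (N M : nat)
  (A : 'M[R]_N) (B : 'M[R]_(N, M)) :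
  (1 <= M)%N -> (M <= N)%N -> (2 <= N)%N ->
  (forall i : 'I_M, \rank (kalman A (col i B)) = N) ->
  (\rank B < N)%N ->
  (forall xbar : 'cV[R]_N, xbar != 0 -> (min_time A B xbar < +oo)%E ->
     (non_lipschitz_at (min_time A B) xbar <-> setS A B xbar)) /\
  (forall (theta : R) (u : R -> 'cV[R]_M),
     rev_optimal A B theta u -> vanishing_hamiltonian A B theta u ->
     forall t0 t, 0 <= t0 -> t0 <= t -> t <= theta ->
       setS A B (rev_sol A B u t0) -> setS A B (rev_sol A B u t)).
Proof.
move=> M1 MN N2 rk rB; split=> [x x0 Tx|theta u [_ [au _]] vh t0 t t00 t0t tth St0].
  split; first exact: non_lipschitz_setS.
  exact: setS_non_lipschitz.
(* At [t = t0] the assumption is the claim, which covers [t = 0]; beyond [t0] the time is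
   positive. *)
move: t0t; rewrite le_eqVlt => /predU1P[<-//|t0t].
apply: (vanishing_hamiltonian_setS rk au vh).
by rewrite (le_lt_trans t00).
Qed.
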